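(* If $\mathcal M(\mathcal T)$ is a decomposable CSmodel (i.e. $\mathcal T$ is a balanced CStree), then $\ker(\psi_{\mathcal T})$ is generated by the quadratic binomials associated to all saturated CSI statements in $\mathcal J(\mathcal T)$, i.e. $$\ker(\psi_{\mathcal T})=I_{\mathrm{Sat}(\mathcal T)}.$$
   Context: Notation. $[p]=\{1,\dots,p\}$; $X_1,\dots,X_p$ are discrete random variables, $X_i$ with state space $[d_i]=\{1,\dots,d_i\}$. For $A\subseteq[p]$ let $\mathcal R_A=\prod_{i\in A}[d_i]$, $\mathcal R=\mathcal R_{[p]}$. For $\mathbf x\in\mathcal R_B$ and $A\subseteq B$, $\mathbf x_A=(x_i)_{i\in A}$; for disjoint $A,B$, $\mathbf x_A\mathbf x_B\in\mathcal R_{A\cup B}$ is the combined outcome. $\mathbb R[D]=\mathbb R[p_{\mathbf x}:\mathbf x\in\mathcal R]$. CStrees. Let $\mathcal T=(V,E)$ be the rooted tree with $V=\{\mathrm{root}\}\cup\bigcup_{j\in[p]}\mathcal R_{[j]}$ and edges $\mathrm{root}\to x_1$ and $x_1\cdots x_{k-1}\to x_1\cdots x_k$. Its $k$-th level is $L_k=\mathcal R_{[k]}$ ($L_0=\{\mathrm{root}\}$); $E(v)$ is the set of outgoing edges of $v$. A labeling $\theta:E\to\mathcal L$ ($\mathcal L$ a finite set) makes $\mathcal T$ a staged tree if $|\theta(E(v))|=|E(v)|$ for all $v$, and $\theta(E(v)),\theta(E(w))$ are equal or disjoint for all $v,w$. Non-leaf vertices $v,w$ are in the same stage iff $\theta(E(v))=\theta(E(w))$;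 the equivalence classes are the stages (leaves are regarded as singleton stages). A staged tree is a CStree if: (1) $\theta(E(v))\ne\theta(E(w))$ for non-leaf $v,w$ in different levels; (2) $\theta(x_1\cdots x_{k-1}\to x_1\cdots x_{k-1}x_k)=\theta(y_1\cdots y_{k-1}\to y_1\cdots y_{k-1}x_k)$ whenever $x_1\cdots x_{k-1}$ and $y_1\cdots y_{k-1}$ are in the same stage; (3) for every $k\in[p]$ and every stage $S\subseteq L_{k-1}$ there are $C\subseteq[k-1]$ and $\mathbf x_C\in\mathcal R_C$ with $S=\{\mathbf x_C\mathbf y:\mathbf y\in\mathcal R_{[k-1]\setminus C}\}$. Balanced. For $v\in L_{k-1}$ let $t(v)=\sum_{\mathbf z\in\mathcal R_{[p]\setminus[k-1]}}\prod_{e\in E(v\to v\mathbf z)}\theta(e)$ in the polynomial ring $\mathbb R[\theta(e):e\in E]$ whose variables are the labels ($E(v\to v\mathbf z)$: edges on the path from $v$ to $v\mathbf z$). $\mathcal T$ is balanced if for every $k\in[p]$, all $v,w\in L_{k-1}$ in the same stage and all $s,r\in[d_k]$: $t(vs)t(wr)=t(vr)t(ws)$ in this ring. A decomposable CSmodel is the model $\mathcal M(\mathcal T)$ of a balanced CStree. The map $\psi_{\mathcal T}$. Let $\langle\theta-1\rangle=\langle\sum_{e\in E(v)}\theta(e)-1: v\in V\text{ non-leaf}\rangle$ and $\mathbb R[\Theta_{\mathcal T}]=\mathbb R[\theta(e):e\in E]/\langle\theta-1\rangle$. With a homogenizing variable $z$, $\psi_{\mathcal T}:\mathbb R[D]\to\mathbb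 R[\Theta_{\mathcal T}][z]$ is the ring homomorphism $p_{\mathbf x}\mapsto z\prod_{e\in E(\mathrm{root}\to\mathbf x)}\theta(e)$, where $E(\mathrm{root}\to\mathbf x)$ is the set of edges of the path from the root to the leaf $\mathbf x$. CSI statements and $\mathcal J(\mathcal T)$. A CSI statement is written $X_A\perp X_B\mid X_S,X_C=\mathbf x_C$ with $A,B,S,C\subseteq[p]$ pairwise disjoint and $\mathbf x_C\in\mathcal R_C$ (trivial if $A$ or $B$ is empty). It is saturated if $A\cup B\cup S\cup C=[p]$. The polynomials associated to a saturated statement are $p_{\mathbf x_A\mathbf x_B\mathbf x_S\mathbf x_C}p_{\mathbf y_A\mathbf y_B\mathbf x_S\mathbf x_C}-p_{\mathbf x_A\mathbf y_B\mathbf x_S\mathbf x_C}p_{\mathbf y_A\mathbf x_B\mathbf x_S\mathbf x_C}$ for all $\mathbf x_A,\mathbf y_A\in\mathcal R_A$, $\mathbf x_B,\mathbf y_B\in\mathcal R_B$, $\mathbf x_S\in\mathcal R_S$. For a stage $S\subseteq L_{k-1}$ let $C\subseteq[k-1]$ be the set of indices at which all elements of $S$ agree and $\mathbf x_C$ the common value; the stage statement is $X_k\perp X_{[k-1]\setminus C}\mid X_C=\mathbf x_C$. $\mathcal J(\mathcal T)$ is the set of all CSI statements derivable from the stage statements by the CSI axioms (all index sets disjoint; $A\perp B|S,\mathbf x_C$ abbreviates $X_A\perp X_B|X_S,X_C=\mathbf x_C$): symmetry: $A\perp B|S,\mathbf x_C\Rightarrow B\perp A|S,\mathbf x_C$;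 decomposition: $A\perp B\cup D|S,\mathbf x_C\Rightarrow A\perp B|S,\mathbf x_C$; weak union: $A\perp B\cup D|S,\mathbf x_C\Rightarrow A\perp B|S\cup D,\mathbf x_C$; contraction: $A\perp B|S\cup D,\mathbf x_C$ and $A\perp D|S,\mathbf x_C\Rightarrow A\perp B\cup D|S,\mathbf x_C$; intersection: $A\perp B|S\cup D,\mathbf x_C$ and $A\perp S|B\cup D,\mathbf x_C\Rightarrow A\perp B\cup S|D,\mathbf x_C$; specialization: $A\perp B|S,\mathbf x_C$, $T\subseteq S$, $\mathbf x_T\in\mathcal R_T\Rightarrow A\perp B|S\setminus T,\mathbf x_{T\cup C}$; absorption: if for some $T\subseteq C$ one has $A\perp B|S,\mathbf x_{C\setminus T}\mathbf x_T$ for all $\mathbf x_T\in\mathcal R_T$, then $A\perp B|S\cup T,\mathbf x_{C\setminus T}$. $\mathrm{Sat}(\mathcal T)$ is the set of saturated statements in $\mathcal J(\mathcal T)$, and $I_{\mathrm{Sat}(\mathcal T)}\subseteq\mathbb R[D]$ is the ideal generated by all polynomials associated to statements in $\mathrm{Sat}(\mathcal T)$. *)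

(* Defs.v *)
From HB Require Import structures.
From mathcomp Require Import all_boot all_order all_algebra.
From mathcomp Require Import generic_quotient ring_quotient.
From mathcomp Require Import mpoly.
From mathcomp Require Import boolp reals.

Set Implicit Arguments.
Unset Strict Implicit.
Unset Printing Implicit Defensive.

Import GRing.Theory.
Local Open Scope ring_scope.
Local Open Scope quotient_scope.

(* Indices are 0-based: [p] is 'I_p = {0, ..., p-1} and the state space of the
   i-th variable is 'I_(d i).  Thus k : 'I_p plays the role of k+1 in [p], and
   its "past" is [set i | i < k]. *)

Section Outcomes.
Variables (p : nat) (d : 'I_p -> nat).

(* The elements of R = R_[p]. *)
Definition outcome := {dffun forall i : 'I_p, 'I_(d i)}.

(* The disjoint union of all R_A, A a subset of [p]: the elements of R_A are
   the partial outcomes c with dom c = A. *)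
Definition poutcome := {dffun forall i : 'I_p, option 'I_(d i)}.

Definition dom (c : poutcome) : {set 'I_p} := [set i | isSome (c i)].

(* x_A, for x in R *)
Definition proj (A : {set 'I_p}) (x : outcome) : poutcome :=
  [ffun i => if i \in A then Some (x i) else None].

(* c_A, for a partial outcome c *)
Definition restr (A : {set 'I_p}) (c : poutcome) : poutcome :=
  [ffun i => if i \in A then c i else None].

(* The combined outcome of b and c; only used when dom b and dom c are
   disjoint. *)
Definition comb (b c : poutcome) : poutcome :=
  [ffun i => if b i is Some s then Some s else c i].

(* y_D x_{[p] \ D} *)
Definition mix (D : {set 'I_p}) (y x : outcome) : outcome :=
  [ffun i => if i \in D then y i else x i].

Definition before (k : nat) : {set 'I_p} := [set i : 'I_p | i < k]%N.

(* L_k = R_[k]; level 0 is the root and level p consists of the leaves. *)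
Definition level (k : nat) := {v : poutcome | dom v == before k}.

Lemma proj_subproof (k : nat) (x : outcome) :
  dom (proj (before k) x) == before k.
Proof. by apply/eqP/setP => i; rewrite !inE !ffunE inE; case: (i < k)%N. Qed.

(* The vertex of level k on the path from the root to the leaf x. *)
Definition anc (k : nat) (x : outcome) : level k :=
  exist _ (proj (before k) x) (proj_subproof k x).

Lemma child_subproof (k : 'I_p) (v : level k) (s : 'I_(d k)) :
  dom [ffun i => dfwith (val v) (Some s) i] == before k.+1.
Proof.
apply/eqP/setP => i; rewrite !inE ffunE ltnS leq_eqVlt.
have [->|ne] := eqVneq i k; first by rewrite dfwith_in eqxx.
rewrite dfwith_out; last by rewrite eq_sym.
have /eqP/setP/(_ i) := valP v; rewrite !inE => ->.
by move: ne; rewrite -val_eqE => /negPf->.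
Qed.

(* The vertex vs, for v in level k and s a state of the k-th variable. *)
Definition child (k : 'I_p) (v : level k) (s : 'I_(d k)) : level k.+1 :=
  exist _ [ffun i => dfwith (val v) (Some s) i] (child_subproof v s).

(* The edge v -> vs of the tree is encoded by the level k of v together with
   the pair (v, s). *)
Definition edge := {k : 'I_p & (level k * 'I_(d k))%type}.

Definition edge_of (k : 'I_p) (v : level k) (s : 'I_(d k)) : edge :=
  Tagged (fun k : 'I_p => (level k * 'I_(d k))%type) (v, s).

(* E(v); for leaves, which are not covered by k : 'I_p, this set is empty. *)
Definition out_edges (k : 'I_p) (v : level k) : {set edge} :=
  [set edge_of v s | s in 'I_(d k)].

(* The edge of the path from the root to x that leaves level k. *)
Definition path_edge (x : outcome) (k : 'I_p) : edge :=
  edge_of (anc k x) (x k).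

End Outcomes.

(* The staged trees on the tree T determined by d.  The state spaces of random
   variables are nonempty.  Leaves have no outgoing edges, so the two conditions
   are void for them. *)
Record staged_tree (p : nat) (d : 'I_p -> nat) (L : finType) := StagedTree {
  theta :> edge d -> L;
  state_gt0 : forall i, (0 < d i)%N;
  theta_inj : forall (k : 'I_p) (v : level d k),
    #|theta @: out_edges v| = #|out_edges v|;
  theta_eq_or_disjoint :
    forall (k l : 'I_p) (v : level d k) (w : level d l),
      theta @: out_edges v = theta @: out_edges w \/
      [disjoint theta @: out_edges v & theta @: out_edges w]
}.

Arguments state_gt0 {p d L} s i.
Arguments theta_inj {p d L} s k v.
Arguments theta_eq_or_disjoint {p d L} s k l v w.

Section CStrees.
Variables (p : nat) (d : 'I_p -> nat) (L : finType) (T : staged_tree d L).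

Definition same_stage (k l : 'I_p) (v : level d k) (w : level d l) : bool :=
  T @: out_edges v == T @: out_edges w.

(* The stage of v; it lies in the level of v by the first condition below. *)
Definition stage (k : 'I_p) (v : level d k) : {set level d k} :=
  [set w | same_stage v w].

Definition CStree : Prop :=
  [/\ forall (k l : 'I_p) (v : level d k) (w : level d l),
        k != l -> T @: out_edges v != T @: out_edges w,
      forall (k : 'I_p) (v w : level d k) (s : 'I_(d k)),
        same_stage v w -> T (edge_of v s) = T (edge_of w s)
    & forall (k : 'I_p) (v : level d k),
        exists c : poutcome d, dom c \subset before p k /\
          stage v = [set w : level d k | restr (dom c) (val w) == c]].

(* The labels that occur on T: the variables of R[theta(e) : e in E]. *)
Definition used_label := {l : L | l \in codom T}.

Definition edge_label (e : edge d) : used_label :=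
  exist _ (T e) (codom_f T e).

End CStrees.

(* R[theta(e) : e in E] *)
Notation label_ring R T := {mpoly R[#|{: used_label T}|]}.

(* R[D]; the variable p_x has index enum_rank x. *)
Notation prob_ring R d := {mpoly R[#|{: outcome d}|]}.

(* The ideal generated by the set G. *)
Definition ideal_gen (A : comNzRingType) (G : A -> Prop) (f : A) : Prop :=
  exists (n : nat) (a g : 'I_n -> A),
    (forall i, G (g i)) /\ f = \sum_(i < n) a i * g i.

Section LabelRing.
Variables (R : realType) (p : nat) (d : 'I_p -> nat) (L : finType).
Variable T : staged_tree d L.

Definition label_var (e : edge d) : label_ring R T :=
  'X_(enum_rank (edge_label T e)).

(* t(v): the sum is over the leaves x = vz below v. *)
Definition interp (k : nat) (v : level d k) : label_ring R T :=
  \sum_(x : outcome d | anc k x == v)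
    \prod_(i < p | (k <= i)%N) label_var (path_edge x i).

Definition balanced : Prop :=
  forall (k : 'I_p) (v w : level d k), same_stage T v w ->
  forall s r : 'I_(d k),
    interp (child v s) * interp (child w r)
    = interp (child v r) * interp (child w s).

Definition sum_to_one (f : label_ring R T) : Prop :=
  exists (k : 'I_p) (v : level d k),
    f = \sum_(e in out_edges v) label_var e - 1.

(* <theta - 1> *)
Definition theta_ideal : {pred label_ring R T} :=
  fun f => `[< ideal_gen sum_to_one f >].

(* 1 is not in the ideal: evaluate each label at 1 / |E(v)|, where v is a
   vertex whose outgoing edges carry that label. *)
Lemma theta_ideal_proper : (1 : label_ring R T) \notin theta_ideal.
Proof.
have labE (l : used_label T) : {e : edge d | T e == val l}.
  by apply: sigW; have /codomP[e le] := valP l; exists e; rewrite -le eqxx.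
pose u (j : 'I_#|{: used_label T}|) : R :=
  (d (tag (sval (labE (enum_val j)))))%:R^-1.
have card_out (k : 'I_p) (v : level d k) : #|out_edges v| = d k.
  rewrite card_imset ?card_ord // => s t /eqP.
  by rewrite -tag_eqE /tag_eq /= eqxx tagged_asE => /eqP[].
have uE (k : 'I_p) (v : level d k) e :
    e \in out_edges v -> meval u (label_var e) = (d k)%:R^-1.
  move=> ev; rewrite mevalXU /u enum_rankK; congr (_%:R^-1).
  case: (labE _) => -[l [w s]] /= /eqP lE.
  have ew : T (edge_of w s) = T e by [].
  have e1 : T e \in T @: out_edges v by exact: imset_f.
  have e2 : T e \in T @: out_edges w by rewrite -ew; exact/imset_f/imset_f.
  have [eqvw|dis] := theta_eq_or_disjoint T _ _ v w.
    by rewrite -(card_out k v) -(card_out l w) -!(theta_inj T) eqvw.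
  by have := disjointFr dis e1; rewrite e2.
apply/negP => /asboolP[n [a [g [gP /(congr1 (meval u))]]]].
rewrite meval1 raddf_sum big1 /= => [/eqP|i _]; first by rewrite oner_eq0.
have [k [v ->]] := gP i.
rewrite mevalM mevalB meval1 raddf_sum (eq_bigr _ (uE k v)) sumr_const.
rewrite card_out -[_ *+ d k]mulr_natl divff ?subrr ?mulr0 //.
by rewrite Num.Theory.pnatr_eq0 -lt0n (state_gt0 T).
Qed.

Lemma theta_ideal_idealr : idealr_closed theta_ideal.
Proof.
split; [|exact: theta_ideal_proper|].
  by apply/asboolP; exists 0, (fun=> 0), (fun=> 0); split; [case|rewrite big_ord0].
move=> b f1 f2 /asboolP[n1 [a1 [g1 [G1 ->]]]] /asboolP[n2 [a2 [g2 [G2 ->]]]].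
apply/asboolP; exists (n1 + n2)%N.
exists (fun i => match split i with inl j => b * a1 j | inr j => a2 j end).
exists (fun i => match split i with inl j => g1 j | inr j => g2 j end).
split=> [i|]; first by case: (split i).
rewrite big_split_ord /= mulr_sumr; congr (_ + _); apply: eq_bigr => i _.
  by rewrite (unsplitK (inl i)) mulrA.
by rewrite (unsplitK (inr i)).
Qed.

HB.instance Definition _ := isIdealr.Build (label_ring R T) theta_ideal theta_ideal_idealr.

(* R[Theta_T] *)
Local Notation param_ring := {ideal_quot theta_ideal}.

Definition pvar (x : outcome d) : prob_ring R d := 'X_(enum_rank x).

Definition param_const : R -> {poly param_ring} :=
  polyC \o \pi_(param_ring) \o @mpolyC _ R.

Definition param_image (x : outcome d) : {poly param_ring} :=
  'X * (\prod_(i < p) \pi_(param_ring) (label_var (path_edge x i)))%:P.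

(* psi_T, with z = 'X. *)
Definition psi : prob_ring R d -> {poly param_ring} :=
  mmap param_const (fun j => param_image (enum_val j)).

HB.instance Definition _ := GRing.RMorphism.on param_const.
HB.instance Definition _ := GRing.RMorphism.on psi.

Lemma psi_pvar (x : outcome d) : psi (pvar x) = param_image x.
Proof. by rewrite /psi mmapX mmap1U enum_rankK. Qed.

End LabelRing.

Notation param_ring R T := {ideal_quot (@theta_ideal R _ _ _ T)}.

(* CSI A B S c is the statement X_A _||_ X_B | X_S, X_C = c, where C = dom c. *)
Record csi (p : nat) (d : 'I_p -> nat) := CSI {
  csiA : {set 'I_p};
  csiB : {set 'I_p};
  csiS : {set 'I_p};
  csic : poutcome d
}.

Section CSI.
Variables (p : nat) (d : 'I_p -> nat).

Definition pairwise_disjoint (As : seq {set 'I_p}) : bool :=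
  pairwise (fun A B : {set 'I_p} => [disjoint A & B]) As.

(* Closure of a set G of statements under the CSI axioms.  The disjointness of
   the index sets is required where it does not already follow from that of
   the premises; in csi_absorption it does because R_T is nonempty. *)
Inductive csi_closure (G : csi d -> Prop) : csi d -> Prop :=
| csi_base st : G st -> csi_closure G st
| csi_symmetry A B S c :
    csi_closure G (CSI A B S c) -> csi_closure G (CSI B A S c)
| csi_decomposition A B D S c :
    pairwise_disjoint [:: A; B; D; S; dom c] ->
    csi_closure G (CSI A (B :|: D) S c) -> csi_closure G (CSI A B S c)
| csi_weak_union A B D S c :
    pairwise_disjoint [:: A; B; D; S; dom c] ->
    csi_closure G (CSI A (B :|: D) S c) -> csi_closure G (CSI A B (S :|: D) c)
| csi_contraction A B D S c :
    pairwise_disjoint [:: A; B; D; S; dom c] ->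
    csi_closure G (CSI A B (S :|: D) c) -> csi_closure G (CSI A D S c) ->
    csi_closure G (CSI A (B :|: D) S c)
| csi_intersection A B D S c :
    pairwise_disjoint [:: A; B; D; S; dom c] ->
    csi_closure G (CSI A B (S :|: D) c) -> csi_closure G (CSI A S (B :|: D) c) ->
    csi_closure G (CSI A (B :|: S) D c)
| csi_specialization A B S c (T : {set 'I_p}) t :
    csi_closure G (CSI A B S c) -> T \subset S -> dom t = T ->
    csi_closure G (CSI A B (S :\: T) (comb t c))
| csi_absorption A B S (C T : {set 'I_p}) c :
    T \subset C -> dom c = C :\: T ->
    (forall t, dom t = T -> csi_closure G (CSI A B S (comb c t))) ->
    csi_closure G (CSI A B (S :|: T) c).

Definition saturated (st : csi d) : Prop :=
  csiA st :|: csiB st :|: csiS st :|: dom (csic st) = setT.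

End CSI.

Section SaturatedIdeal.
Variables (R : realType) (p : nat) (d : 'I_p -> nat) (L : finType).
Variable T : staged_tree d L.

(* The indices below k at which all elements of the stage of v agree. *)
Definition stage_context (k : 'I_p) (v : level d k) : {set 'I_p} :=
  [set i in before p k | [forall w in stage T v, val w i == val v i]].

Definition stage_statement (k : 'I_p) (v : level d k) : csi d :=
  CSI [set k] (before p k :\: stage_context v) set0
    (restr (stage_context v) (val v)).

(* J(T) *)
Definition J : csi d -> Prop :=
  csi_closure (fun st => exists (k : 'I_p) (v : level d k),
                 st = stage_statement v).

Definition Sat (st : csi d) : Prop := J st /\ saturated st.

(* The polynomials associated to a saturated statement: x is the outcome
   x_A x_B x_S x_C, while y provides y_A and y_B. *)
Definition csi_poly (st : csi d) (f : prob_ring R d) : Prop :=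
  exists x y : outcome d, proj (dom (csic st)) x = csic st /\
    f = pvar R x * pvar R (mix (csiA st :|: csiB st) y x)
        - pvar R (mix (csiB st) y x) * pvar R (mix (csiA st) y x).

(* Membership in the ideal I_{Sat(T)} of R[D]. *)
Definition I_Sat (f : prob_ring R d) : Prop :=
  ideal_gen (fun g : prob_ring R d => exists st, Sat st /\ csi_poly st g) f.

End SaturatedIdeal.

(* Main.v *)
(* Write K(x,k) for the context of the stage of the prefix x_1 ... x_(k-1).

   Balancedness makes the contexts perfect: if k is in K(x,j) and X_k has at
   least two states, then all i < k in K(x,j) are in K(x,k).
   This has two consequences.

   (1) Let C be K(x,k) together with the indices of variables with one state.
   If x and y have the same stage at k, then the complement of C splits into a
   part D, consisting of k and later indices, and a rest D' such that
   D _||_ D' | X_C = x_C is derivable from the stage statements.  Exchanging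
   the D-coordinates of x and y is thus a saturated move, which exchanges the
   states at k and leaves all earlier ones alone.
   Given two monomials with equal images, one row of the first can be turned
   into a row of the second, level by level, by such moves.  Hence fibers are
   connected modulo I_Sat.

   (2) The sum of the labels of a stage at level k depends only on the context,
   hence, by perfectness, on a single label of a lower level, which can absorb
   it.  So every positive choice of labels gives the same point, up to scaling,
   as one in which the labels of each stage sum to 1: dividing by <theta - 1>
   does not enlarge the kernel.

   The CSI axioms are sound for positive distributions, so elements of I_Sat
   vanish on all such points; conversely a polynomial vanishing on them has
   coefficients summing to 0 over each fiber, by independence of characters. *)
Require Import Defs.
From HB Require Import structures.
From mathcomp Require Import all_boot all_order all_algebra.
From mathcomp Require Import generic_quotient ring_quotient mpoly reals.
From mathcomp Require Import boolp ring lra.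

Set Implicit Arguments.
Unset Strict Implicit.
Unset Printing Implicit Defensive.

Import Order.TTheory GRing.Theory Num.Theory.
Local Open Scope ring_scope.

(** * Outcomes and stage contexts *)

Lemma prodr_ege1 (R : numDomainType) (I : Type) (r : seq I) (P : pred I) (F : I -> R) :
  (forall i, P i -> 1 <= F i) -> 1 <= \prod_(i <- r | P i) F i.
Proof.
by move=> F1; apply: (big_ind (fun t => 1 <= t)) => // u v; exact: mulr_ege1.
Qed.

Section Agreement.
Variables (p : nat) (d : 'I_p -> nat).
Implicit Types (x y z : outcome d) (A B C D : {set 'I_p}).

Definition agree A x y := [forall i in A, x i == y i].

Lemma agreeP A x y : reflect (forall i, i \in A -> x i = y i) (agree A x y).
Proof. by apply: (iffP forall_inP) => H i /H /eqP. Qed.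

Lemma agree_at A x y i : agree A x y -> i \in A -> x i = y i.
Proof. by move/agreeP; apply. Qed.

Lemma agree_refl A x : agree A x x.
Proof. exact/agreeP. Qed.

Lemma agree_sym A x y : agree A x y = agree A y x.
Proof. by apply/agreeP/agreeP => H i /H. Qed.

Lemma agree_trans A : transitive (agree A).
Proof. by move=> y x z /agreeP xy /agreeP yz; apply/agreeP => i iA; rewrite xy ?yz. Qed.

Lemma agree_sub A B x y : A \subset B -> agree B x y -> agree A x y.
Proof. by move=> /subsetP AB /agreeP H; apply/agreeP => i /AB /H. Qed.

Lemma agree_setU A B x y : agree (A :|: B) x y = agree A x y && agree B x y.
Proof.
apply/agreeP/andP => [H|[/agreeP HA /agreeP HB] i]; last by case/setUP=> [/HA|/HB].
by split; apply/agreeP => i iA; apply: H; rewrite inE iA ?orbT.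
Qed.

Lemma agree_setT x y : agree setT x y = (x == y).
Proof.
apply/agreeP/eqP => [H|-> //]; by apply/ffunP => i; exact: H.
Qed.

Lemma proj_agree A x y : (proj A x == proj A y) = agree A x y.
Proof.
apply/eqP/agreeP => [/ffunP H i iA|H].
  by have := H i; rewrite !ffunE iA => -[].
by apply/ffunP => i; rewrite !ffunE; case: ifP => // /H ->.
Qed.

Lemma dom_proj A x : dom (proj A x) = A.
Proof. by apply/setP => i; rewrite inE ffunE; case: (i \in A). Qed.

Lemma mix_in D y x i : i \in D -> mix D y x i = y i.
Proof. by rewrite ffunE => ->. Qed.

Lemma mix_out D y x i : i \notin D -> mix D y x i = x i.
Proof. by rewrite ffunE => /negPf ->. Qed.

Lemma agree_mix_in D y x : agree D (mix D y x) y.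
Proof. by apply/agreeP => i /mix_in ->. Qed.

Lemma agree_mix_out A D y x : [disjoint A & D] -> agree A (mix D y x) x.
Proof. by move=> dis; apply/agreeP => i iA; rewrite mix_out // (disjointFr dis). Qed.

Lemma comb_proj A B x : comb (proj A x) (proj B x) = proj (A :|: B) x.
Proof.
by apply/ffunP => i; rewrite !ffunE !inE; case: (i \in A); case: (i \in B).
Qed.

Lemma anc_eq k x y : (anc k x == anc k y) = agree (before p k) x y.
Proof. by rewrite -val_eqE /= proj_agree. Qed.

Lemma val_anc k x (i : 'I_p) : (i < k)%N -> val (anc k x) i = Some (x i).
Proof. by move=> ik; rewrite /= ffunE inE ik. Qed.

Lemma disjoint_pointwise A B :
  (forall i, i \in A -> i \in B -> false) -> [disjoint A & B].
Proof.
by move=> H; rewrite -setI_eq0; apply/set0Pn => -[i /setIP[/H h /h]].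
Qed.

(** Lets case analysis on the memberships of a single index settle the disjointness side conditions
    of the CSI axioms. *)
Lemma pairwise_disjoint_count (As : seq {set 'I_p}) :
  (forall i, (count (fun A : {set 'I_p} => i \in A) As <= 1)%N) ->
  pairwise_disjoint As.
Proof.
rewrite /pairwise_disjoint; elim: As => //= A As IH H; apply/andP; split; last first.
  by apply: IH => i; apply: leq_trans (leq_addl _ _) (H i).
apply/allP => B BAs; apply: disjoint_pointwise => i iA iB.
have := H i; rewrite iA addnC addn1 ltnS leqNgt -has_count => /hasPn/(_ B BAs).
by rewrite iB.
Qed.

Lemma disjoint_and A B i : [disjoint A & B] -> (i \in A) && (i \in B) = false.
Proof. by move=> dis; case: (boolP (i \in A)) => // /(disjointFr dis). Qed.

Lemma eq_ltnF (i j : 'I_p) : (i == j) && (i < j)%N = false.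
Proof. by case: eqP => // ->; rewrite ltnn. Qed.

Hypothesis d_gt0 : forall i, (0 < d i)%N.

Lemma poutcome_extends (c : poutcome d) : exists x, proj (dom c) x = c.
Proof.
exists [ffun i => if c i is Some s then s else Ordinal (d_gt0 i)].
by apply/ffunP => i; rewrite !ffunE inE; case: (c i).
Qed.

Lemma level_anc k (v : level d k) : exists x, v = anc k x.
Proof.
have [x xv] := poutcome_extends (val v).
by exists x; apply: val_inj; rewrite -[LHS]xv (eqP (valP v)).
Qed.

End Agreement.

(** * Stage contexts and the labels they determine *)

Section StageContexts.
Variables (p : nat) (d : 'I_p -> nat) (L : finType) (T : staged_tree d L).
Hypothesis hT : CStree T.
Implicit Types (x y z : outcome d) (i j k l : 'I_p).

Definition lab x k : L := T (path_edge x k).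

(* Locked, so that rewriting with [inE] does not look inside. *)
Fact ctx_key : unit. Proof. exact: tt. Qed.
Definition ctx x k : {set 'I_p} :=
  locked_with ctx_key (stage_context T (anc k x)).

Lemma in_ctx x k i : (i \in ctx x k) = (i < k)%N &&
  [forall w in stage T (anc k x), val w i == val (anc k x) i].
Proof. by rewrite /ctx locked_withE !inE. Qed.

Lemma ctx_lt x k i : i \in ctx x k -> (i < k)%N.
Proof. by rewrite in_ctx => /andP[]. Qed.

(** By the third CStree condition the stage is a cylinder over some [c]. Its elements agree on
    [dom c], so [dom c] lies in the context, and agreement on the context forces membership. The two
    sets can differ at one-state variables. *)
Lemma same_stage_ctx x y k :
  same_stage T (anc k x) (anc k y) = agree (ctx x k) x y.
Proof.
apply/idP/agreeP => [s i ic|H].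
  have ik := ctx_lt ic.
  move: ic; rewrite in_ctx => /andP[_ /forall_inP/(_ (anc k y))].
  by rewrite inE s !val_anc // => /(_ isT)/eqP[].
case: hT => _ _ /(_ k (anc k x))[c [/subsetP cb cyl]].
have inS (w : level d k) : same_stage T (anc k x) w = (restr (dom c) (val w) == c).
  by move/setP/(_ w): cyl; rewrite !inE.
have rE (w : level d k) : same_stage T (anc k x) w -> forall i, i \in dom c -> val w i = c i.
  rewrite inS => /eqP/ffunP e i ic.
  by have := e i; rewrite ffunE ic.
have xE := rE (anc k x) (eqxx _).
rewrite inS; apply/eqP/ffunP => i; rewrite ffunE.
case: ifP => [ic|]; last by rewrite inE; case: (c i).
have ik : (i < k)%N by have := cb _ ic; rewrite inE.
rewrite -xE // !val_anc // H // in_ctx ik /=.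
by apply/forall_inP => w; rewrite inE => sw; rewrite (rE _ sw) // xE.
Qed.

Lemma ctx_eq x y k : agree (ctx x k) x y -> ctx x k = ctx y k.
Proof.
rewrite -same_stage_ctx => s.
have sE : stage T (anc k x) = stage T (anc k y).
  by apply/setP => w; rewrite !inE /same_stage (eqP s).
apply/setP => i; rewrite !in_ctx sE; case: (ltnP i k) => //= ik.
have ys : anc k y \in stage T (anc k y) by rewrite inE /same_stage.
have xs : anc k x \in stage T (anc k y) by rewrite -sE inE /same_stage.
apply/forall_inP/forall_inP => H w ws.
  by rewrite (eqP (H w ws)) eq_sym; apply: (H (anc k y)).
by rewrite (eqP (H w ws)) eq_sym; apply: (H (anc k x)).
Qed.

Lemma ctx_maximal x k i : (i < k)%N ->
  (forall y, agree (ctx x k) x y -> y i = x i) -> i \in ctx x k.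
Proof.
move=> ik H; rewrite in_ctx ik /=; apply/forall_inP => w.
have [y ->] := level_anc (state_gt0 T) w.
by rewrite inE same_stage_ctx !val_anc // => /H ->.
Qed.

Lemma ord_eq1 n (s t : 'I_n) : ~~ (1 < n)%N -> s = t.
Proof.
case: n s t => [|[|n]] s t // _; first by case: s.
by rewrite !ord1.
Qed.

Lemma ctx_trivial x k i : (i < k)%N -> ~~ (1 < d i)%N -> i \in ctx x k.
Proof. by move=> ik di; apply: ctx_maximal => // y _; exact: ord_eq1. Qed.

Lemma edge_of_inj k (v : level d k) : injective (@edge_of p d k v).
Proof.
move=> s t /eqP; rewrite -tag_eqE /tag_eq /= eqxx tagged_asE.
by move=> /eqP[].
Qed.

Lemma label_inj k (v : level d k) : injective (fun s => T (edge_of v s)).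
Proof.
move=> s t; have /eqP/imset_injP inj := theta_inj T k v.
by move/inj => /(_ (imset_f _ _) (imset_f _ _))/edge_of_inj; apply.
Qed.

Lemma label_same_stage k l (v : level d k) (w : level d l) s t :
  T (edge_of v s) = T (edge_of w t) -> T @: out_edges v = T @: out_edges w.
Proof.
move=> e; have [//|dis] := theta_eq_or_disjoint T k l v w.
have h1 : T (edge_of v s) \in T @: out_edges v by exact/imset_f/imset_f.
have h2 : T (edge_of w t) \in T @: out_edges w by exact/imset_f/imset_f.
by rewrite -e (disjointFr dis h1) in h2.
Qed.

Lemma lab_level x y k l : lab x k = lab y l -> k = l.
Proof.
move=> /label_same_stage e; apply/eqP/negPn/negP => kl.
by case: hT => /(_ k l (anc k x) (anc l y) kl); rewrite e eqxx.
Qed.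

(** Equal labels force equal stages, stage mates share labels state by state by the second CStree
    condition, and the labels leaving one vertex are distinct. *)
Lemma lab_eq x y k : (lab x k == lab y k) = agree (ctx x k) x y && (x k == y k).
Proof.
rewrite -same_stage_ctx; have [_ h2 _] := hT.
apply/eqP/andP => [e|[s /eqP e]]; last by rewrite /lab /path_edge (h2 _ _ _ _ s) e.
have s : same_stage T (anc k x) (anc k y) by apply/eqP; exact: label_same_stage e.
split=> //; apply/eqP/(label_inj (v := anc k y)).
by rewrite -(h2 _ _ _ _ s).
Qed.

Lemma stage_statement_anc x k : stage_statement T (anc k x) =
  CSI [set k] (before p k :\: ctx x k) set0 (proj (ctx x k) x).
Proof.
rewrite /stage_statement -(locked_withE ctx_key (stage_context _ _)) -/(ctx x k).
congr CSI; apply/ffunP => i; rewrite !ffunE.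
by case: ifP => // /ctx_lt ik; rewrite inE ik.
Qed.

Lemma J_stage x k :
  J T (CSI [set k] (before p k :\: ctx x k) set0 (proj (ctx x k) x)).
Proof. by apply: csi_base; exists k, (anc k x); rewrite stage_statement_anc. Qed.

End StageContexts.

(** * Perfectness of the contexts *)

Section Perfect.
Variables (R : realType) (p : nat) (d : 'I_p -> nat) (L : finType).
Variable T : staged_tree d L.
Implicit Types (x y z : outcome d) (i j k l : 'I_p) (E : L -> R).

Definition label_point E (j : 'I_#|{: used_label T}|) : R :=
  E (val (enum_val j)).

Lemma meval_label_var E (e : edge d) :
  meval (label_point E) (label_var R T e) = E (T e).
Proof. by rewrite mevalXU /label_point enum_rankK. Qed.

Lemma meval_interp E (k : nat) x :
  meval (label_point E) (interp R T (anc k x)) =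
  \sum_(y | agree (before p k) y x) \prod_(i < p | (k <= i)%N) E (lab T y i).
Proof.
rewrite raddf_sum; apply: eq_big => [y|y _]; first by rewrite anc_eq.
by rewrite /= rmorph_prod; apply: eq_bigr => i _; rewrite /= meval_label_var.
Qed.

Definition upd x k (s : 'I_(d k)) : outcome d := [ffun i => dfwith x s i].

Lemma upd_eq x k (s : 'I_(d k)) : upd x s k = s.
Proof. by rewrite ffunE dfwith_in. Qed.

Lemma upd_neq x k (s : 'I_(d k)) i : i != k -> upd x s i = x i.
Proof. by move=> ik; rewrite ffunE dfwith_out // eq_sym. Qed.

Lemma upd_lt x k (s : 'I_(d k)) i : (i < k)%N -> upd x s i = x i.
Proof. by move=> ik; rewrite upd_neq // -val_eqE ltn_eqF. Qed.

Lemma upd_gt x k (s : 'I_(d k)) i : (k < i)%N -> upd x s i = x i.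
Proof. by move=> ik; rewrite upd_neq // -val_eqE gtn_eqF. Qed.

Lemma child_anc x k (s : 'I_(d k)) : child (anc k x) s = anc k.+1 (upd x s).
Proof.
apply: val_inj; apply/ffunP => i; rewrite !ffunE inE ltnS leq_eqVlt val_eqE.
have [->|ik] := eqVneq i k; first by rewrite !dfwith_in.
by rewrite !dfwith_out // 1?eq_sym // ffunE inE.
Qed.

Hypothesis hT : CStree T.
Hypothesis hbal : balanced R T.

(* Balancedness is compared at the point where the labels of [x] and [y] below
   level [k] get weight 1, except that [lab x j] gets weight 2: exchanging the
   states at [k] destroys the label [lab x j], so the two sides differ. *)
Lemma ctx_perfect x i j k : k \in ctx T x j -> (1 < d k)%N ->
  i \in ctx T x j -> (i < k)%N -> i \in ctx T x k.
Proof.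
move=> kj dk ij ik; apply: ctx_maximal => // y0 xy0; apply/eqP/negPn/negP => yi.
have kltj := ctx_lt kj.
have [r rx] : exists r : 'I_(d k), r != x k.
  have [->|n0] := eqVneq (x k) (Ordinal (ltnW dk)); first by exists (Ordinal dk).
  by exists (Ordinal (ltnW dk)); rewrite eq_sym.
(* [y] runs along [y0] before [k], takes the new state [r] at [k] and follows [x] afterwards. It
   shares the stage of [x] at [k]. *)
pose y := upd (mix (before p k) y0 x) r.
have y_lt l : (l < k)%N -> y l = y0 l.
  by move=> lk; rewrite upd_lt // mix_in // inE.
have y_gt l : (k < l)%N -> y l = x l.
  by move=> lk; rewrite upd_gt // mix_out // inE -leqNgt ltnW.
have xy : same_stage T (anc k x) (anc k y).
  rewrite same_stage_ctx //; apply: agree_trans xy0 _.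
  by apply/agreeP => l /ctx_lt /y_lt ->.
pose a := upd x r; pose b := upd y (x k).
pose M := [set lab T z l | z in [set x; y], l in [set l : 'I_p | (k < l)%N]].
pose E (e : L) : R := if e == lab T x j then 2 else (e \in M)%:R.
have E_ge0 e : 0 <= E e by rewrite /E; case: ifP => // _; case: (_ \in _).
have := congr1 (meval (label_point E)) (hbal xy (x k) r).
rewrite !child_anc !mevalM !meval_interp -/a -/b.
have -> : upd x (x k) = x.
  by apply/ffunP => l; have [->|lk] := eqVneq l k; rewrite ?upd_eq ?upd_neq.
have -> : upd y r = y.
  by apply/ffunP => l; have [->|lk] := eqVneq l k; rewrite ?upd_eq ?upd_neq.
have inM z l : z \in [set x; y] -> (k < l)%N -> lab T z l \in M.
  by move=> zxy kl; apply/imset2P; exists z l => //; rewrite inE.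
have xM l : (k < l)%N -> lab T x l \in M by apply: inM; rewrite !inE eqxx.
have yM l : (k < l)%N -> lab T y l \in M by apply: inM; rewrite !inE eqxx orbT.
have E_ge1 e : e \in M -> 1 <= E e by rewrite /E => ->; case: ifP; rewrite ?ler1n.
pose F z := \prod_(l < p | (k.+1 <= l)%N) E (lab T z l).
have F_ge0 z : 0 <= F z by apply: prodr_ge0 => l _; exact: E_ge0.
have lower z : F z <= \sum_(z' | agree (before p k.+1) z' z) F z'.
  by rewrite (bigD1 z) ?agree_refl //= lerDl sumr_ge0.
(* A leaf of nonzero weight uses only labels of [M], and these fix each state beyond [k] to that of
   [x]. So [z] alone contributes, with all factors 0 or 1. *)
have upper z : (forall l, (k < l)%N -> z l = x l) ->
    (forall l, lab T z l != lab T x j) ->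
    \sum_(z' | agree (before p k.+1) z' z) F z' <= 1.
  move=> zx zj; rewrite (bigD1 z) ?agree_refl //= big1 ?addr0.
    apply: prodr_ile1 => l _; rewrite E_ge0 /= /E (negPf (zj l)).
    by case: (_ \in _).
  move=> z' /andP[/agreeP z'z z'nz]; apply/eqP/negPn/negP => Fz'.
  case/eqP: z'nz; apply/ffunP => l; case: (ltnP l k.+1) => [lk|kl].
    by apply: z'z; rewrite inE.
  have : E (lab T z' l) != 0 by apply: contraNneq Fz' => e; rewrite /F (bigD1 l) //= [E _]e mul0r.
  have lM : E (lab T z' l) != 0 -> lab T z' l \in M.
    rewrite /E; have [-> _|_] := eqVneq (lab T z' l); first exact: xM.
    by case: (_ \in _); rewrite ?eqxx.
  move/lM => /imset2P[u m]; rewrite !inE => uxy _ e.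
  have lm := lab_level hT e; rewrite -{}lm in e.
  have /andP[_ /eqP ->] : agree (ctx T z' l) z' u && (z' l == u l).
    by rewrite -lab_eq // e.
  by rewrite zx //; case/orP: uxy => /eqP ->; rewrite ?y_gt.
have Fx : 2 <= F x.
  rewrite /F (bigD1 j) //= {1}/E eqxx -[leLHS]mulr1 ler_pM2l //.
  by apply: prodr_ege1 => l /andP[kl _]; exact/E_ge1/xM.
have Fy : 1 <= F y by apply: prodr_ege1 => l kl; exact/E_ge1/yM.
(* A label determines the states on its context, so a change inside [ctx T x j] excludes
   [lab T x j]. The change is at [k] for [a] and at [i] for [b]. *)
have notlab z l m : m \in ctx T x j -> z m != x m -> lab T z l != lab T x j.
  move=> mj zm; apply/eqP => e; have lj := lab_level hT e; rewrite {}lj in e.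
  have : lab T x j == lab T z j by rewrite e.
  by rewrite lab_eq // => /andP[/agreeP/(_ m mj) xzm _]; rewrite xzm eqxx in zm.
have Fa : \sum_(z' | agree (before p k.+1) z' a) F z' <= 1.
  apply: upper => [l kl|l]; first by rewrite upd_gt.
  by apply: (notlab _ _ k) => //; rewrite upd_eq.
have Fb : \sum_(z' | agree (before p k.+1) z' b) F z' <= 1.
  apply: upper => [l kl|l]; first by rewrite upd_gt ?y_gt.
  by apply: (notlab _ _ i) => //; rewrite upd_lt // y_lt //; exact/eqP.
have := lower x; have := lower y; move: Fa Fb.
rewrite -/F; set sa := (X in X <= 1); move=> Fa.
set sb := (X in X <= 1); move=> Fb.
set sy := (X in _ <= X); move=> Fsy; set sx := (X in _ <= X); move=> Fsx e.
have : 2 * 1 <= sx * sy by apply: ler_pM => //; [exact: le_trans Fsx|exact: le_trans Fsy].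
have : sa * sb <= 1 * 1 by apply: ler_pM => //; apply: sumr_ge0.
have := e : sx * sy = sa * sb.
lra.
Qed.

End Perfect.

(** * Saturated moves *)

Section SaturatedMoves.
Variables (R : realType) (p : nat) (d : 'I_p -> nat) (L : finType).
Variable T : staged_tree d L.
Hypothesis hT : CStree T.
Hypothesis hbal : balanced R T.
Implicit Types (x y z : outcome d) (i j k l : 'I_p) (A B C D : {set 'I_p}).

(** For each value of [D1] the stage statement of [j] gives independence from [D2]. Absorption
    collects these values into one conditional statement, and contraction with the given one puts
    [j] on the side of [D1]. *)
Lemma J_extend x j D1 D2 C :
    D1 :|: D2 :|: C = before p j ->
    [disjoint D1 & D2] -> [disjoint D1 & C] -> [disjoint D2 & C] ->
    (forall z, agree C z x -> [disjoint ctx T z j & D2]) ->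
    J T (CSI D1 D2 set0 (proj C x)) ->
  J T (CSI (j |: D1) D2 set0 (proj C x)).
Proof.
move=> DC d12 d1C d2C dis JD; have DCi i : [|| i \in D1, i \in D2 | i \in C] = (i < j)%N.
  by move/setP/(_ i): DC; rewrite !inE -orbA.
have indep z : agree C z x -> J T (CSI [set j] D2 set0 (proj (D1 :|: C) z)).
  move=> zx; have dis2 := dis z zx.
  pose E := (D1 :|: C) :\: ctx T z j.
  have ctxE : E :|: ctx T z j = D1 :|: C.
    apply/setP => i; rewrite !inE; case: (boolP (i \in ctx T z j)) => [ic|_].
      by have := DCi i; rewrite (ctx_lt ic) (disjointFr dis2 ic) /= => ->.
    by rewrite /= orbF.
  have : J T (CSI [set j] (D2 :|: E) set0 (proj (ctx T z j) z)).
    have -> : D2 :|: E = before p j :\: ctx T z j; last exact: J_stage.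
    apply/setP => i; rewrite !inE -DCi; case: (boolP (i \in ctx T z j)) => [ic|_].
      by rewrite (disjointFr dis2 ic).
    by rewrite /= orbCA orbA.
  have pd : pairwise_disjoint [:: [set j]; D2; E; set0; dom (proj (ctx T z j) z)].
    apply: pairwise_disjoint_count => i; rewrite dom_proj /= !inE.
    have := DCi i; have := introT implyP (@ctx_lt _ _ _ T z j i).
    move: (disjoint_and i d12) (disjoint_and i d2C) (disjoint_and i dis2).
    by move: (eq_ltnF i j); case: (i == j); case: (i \in D1); case: (i \in D2); case: (i \in C);
      case: (i \in ctx T z j); case: (i < j)%N.
  move=> Jw; have := csi_specialization (csi_weak_union pd Jw) (subsetUr set0 E) (dom_proj E z).
  by rewrite comb_proj ctxE set0U setDv.
have Jabs : J T (CSI [set j] D2 (set0 :|: D1) (proj C x)).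
  apply: (csi_absorption (C := D1 :|: C)); first exact: subsetUl.
    rewrite dom_proj setDUl setDv set0U; apply/esym/setDidPl.
    by rewrite disjoint_sym.
  move=> t tD; have [y yt] := poutcome_extends (state_gt0 T) t.
  have zx : agree C (mix D1 y x) x by apply: agree_mix_out; rewrite disjoint_sym.
  have := indep _ zx; congr (J T (CSI _ _ _ _)); apply/ffunP => i; rewrite !ffunE inE.
  rewrite -yt tD !ffunE; case: (boolP (i \in D1)) => [i1|_] /=.
    by rewrite (disjointFr d1C i1).
  by case: (i \in C).
apply: csi_symmetry; apply: csi_contraction _ (csi_symmetry Jabs) (csi_symmetry JD).
apply: pairwise_disjoint_count => i; rewrite dom_proj /= !inE.
move: (disjoint_and i d12) (disjoint_and i d2C) (disjoint_and i d1C) (DCi i).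
by move: (eq_ltnF i j); case: (i == j); case: (i < j)%N; case: (i \in D1); case: (i \in D2); case: (i \in C).
Qed.

(** Weak union makes [j] a conditioning index, and specialization fixes its state. *)
Lemma J_condition x j D1 D2 C :
    j \notin D1 -> j \notin D2 -> j \notin C ->
    [disjoint D1 & D2] -> [disjoint D1 & C] -> [disjoint D2 & C] ->
    J T (CSI (j |: D1) D2 set0 (proj C x)) ->
  J T (CSI D1 D2 set0 (proj (j |: C) x)).
Proof.
move=> j1 j2 jC d12 d1C d2C /csi_symmetry; rewrite setUC => JD.
have pd : pairwise_disjoint [:: D2; D1; [set j]; set0; dom (proj C x)].
  apply: pairwise_disjoint_count => i; rewrite dom_proj /= !inE.
  case: eqVneq => [->|_]; first by rewrite (negPf j1) (negPf j2) (negPf jC).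
  move: (disjoint_and i d12) (disjoint_and i d2C) (disjoint_and i d1C).
  by case: (i \in D1); case: (i \in D2); case: (i \in C).
have := csi_specialization (csi_weak_union pd JD) (subsetUr set0 [set j]) (dom_proj [set j] x).
by rewrite comb_proj set0U setDv => /csi_symmetry.
Qed.

(* The step where perfectness enters: as no vertex is attached to both sides,
   the context of [j] avoids one of them, and the same one in all outcomes. *)
Lemma ctx_dichotomy x j D1 D2 C :
    D1 :|: D2 :|: C = before p j ->
    [disjoint D1 & D2] -> [disjoint D1 & C] -> [disjoint D2 & C] ->
    (forall i, i \in D1 :|: D2 -> (1 < d i)%N) ->
    (forall z, agree C z x -> forall b, b \in D1 -> [disjoint ctx T z b & D2]) ->
    (forall z, agree C z x -> forall b, b \in D2 -> [disjoint ctx T z b & D1]) ->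
  (forall z, agree C z x -> [disjoint ctx T z j & D2]) \/
  (forall z, agree C z x -> [disjoint ctx T z j & D1]).
Proof.
move=> DC d12 d1C d2C nontriv sep1 sep2.
(* If the context of [j] met both sides, perfectness would put the earlier of the two indices into
   the context of the later one, against the separation. *)
have one z : agree C z x -> [disjoint ctx T z j & D2] || [disjoint ctx T z j & D1].
  move=> zx; apply/norP => -[/pred0Pn[b /andP[bj b2]] /pred0Pn[a /andP[aj a1]]].
  rewrite /= in a1 b2 aj bj.
  have [ab|ba|/val_inj ab] := ltngtP a b.
  - have := ctx_perfect hT hbal bj (nontriv b _) aj ab; rewrite inE b2 orbT => /(_ isT) ac.
    by have := disjointFr (sep2 z zx b b2) ac; rewrite a1.
  - have := ctx_perfect hT hbal aj (nontriv a _) bj ba; rewrite inE a1 => /(_ isT) bc.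
    by have := disjointFr (sep1 z zx a a1) bc; rewrite b2.
  - by have := disjointFr d12 a1; rewrite ab b2.
have [|/existsNP[z /not_implyP[zx z2]]] :=
  EM (forall z, agree C z x -> [disjoint ctx T z j & D2]); first by left.
right=> w wx; apply/negPn/negP => w1.
have w2 : [disjoint ctx T w j & D2] by have := one w wx; rewrite (negPf w1) orbF.
have z1 : [disjoint ctx T z j & D1].
  by have := one z zx; case/orP.
have ctxC u i : i \in ctx T u j -> [|| i \in D1, i \in D2 | i \in C].
  by move/ctx_lt; move/setP/(_ i): DC; rewrite !inE -orbA => ->.
(* [u] agrees with [w] on the context of [w] and with [z] on that of [z]. Hence the two contexts
   coincide, although only one of them meets [D1]. *)
pose u := mix D1 w z.
have uw : agree (ctx T w j) w u.
  apply/agreeP => i iw; have := ctxC _ _ iw; rewrite (disjointFr w2 iw) /=.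
  case: (boolP (i \in D1)) => [i1 _|i1 /= iC]; first by rewrite mix_in.
  by rewrite mix_out //; move/agreeP: wx => ->//; move/agreeP: zx => ->.
have uz : agree (ctx T z j) z u.
  by apply/agreeP => i iz; rewrite mix_out // (disjointFr z1 iz).
by case/negP: w1; rewrite (ctx_eq hT uw) -(ctx_eq hT uz).
Qed.

(* [D1] collects the indices below [m] that are exchanged together with [k],
   [D2] those that are not; trivial indices above [k] are moved to [C]. *)
Record separates x k (m : nat) D1 D2 C : Prop := Separates {
  sep_cover : D1 :|: D2 :|: C = before p m;
  sep_12 : [disjoint D1 & D2];
  sep_1C : [disjoint D1 & C];
  sep_2C : [disjoint D2 & C];
  sep_in : k \in D1;
  sep_ge i : i \in D1 -> (k <= i)%N;
  sep_cond i : i \in C -> i \in ctx T x k \/ ~~ (1 < d i)%N;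
  sep_nontrivial i : i \in D1 :|: D2 -> (1 < d i)%N;
  sep_ctx1 z b : agree C z x -> b \in D1 -> [disjoint ctx T z b & D2];
  sep_ctx2 z b : agree C z x -> b \in D2 -> [disjoint ctx T z b & D1];
  sep_J : J T (CSI D1 D2 set0 (proj C x))
}.

Lemma separation_base x k : (1 < d k)%N ->
  separates x k k.+1 [set k] (before p k :\: ctx T x k) (ctx T x k).
Proof.
move=> dk; split.
- apply/setP => i; rewrite !inE ltnS [in RHS]leq_eqVlt -val_eqE /=.
  case: eqP => //= _; case: (boolP (i \in ctx T x k)) => [/ctx_lt ->|]; first by [].
  by rewrite orbF.
- by apply: disjoint_pointwise => i /set1P ->; rewrite !inE ltnn andbF.
- by apply: disjoint_pointwise => i /set1P -> /ctx_lt; rewrite ltnn.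
- by apply: disjoint_pointwise => i /setDP[_ /negPf ->].
- by rewrite inE.
- by move=> i /set1P ->.
- by left.
- move=> i; rewrite !inE => /orP[/eqP ->//|/andP[ni ik]].
  by apply: contraNT ni => di; exact: ctx_trivial.
- move=> z b zx /set1P ->; have <- : ctx T x k = ctx T z k by apply: ctx_eq => //; rewrite agree_sym.
  by apply: disjoint_pointwise => i ic; rewrite !inE ic.
- move=> z b _; rewrite !inE => /andP[_ bk]; apply: disjoint_pointwise => i /ctx_lt ib /set1P ik.
  by rewrite ik ltnNge ltnW in ib.
- exact: J_stage.
Qed.

Lemma separation_step x j k D1 D2 C :
  separates x k j D1 D2 C -> exists D1' D2' C', separates x k j.+1 D1' D2' C'.
Proof.
move=> S; have [DC d12 d1C d2C kD Dk Ctriv nontriv sep1 sep2 JD] := S.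
have DCi i : [|| i \in D1, i \in D2 | i \in C] = (i < j)%N.
  by move/setP/(_ i): DC; rewrite !inE -orbA.
have := DCi j; rewrite ltnn => /norP[j1 /norP[j2 jC]].
have beforeS : before p j.+1 = j |: before p j.
  by apply/setP => i; rewrite !inE ltnS leq_eqVlt.
have kj : (k < j)%N by rewrite -DCi kD.
have ctx_new z b : b \in D1 :|: D2 -> j \notin ctx T z b.
  move=> bD; apply/negP => /ctx_lt jb; have : (b < j)%N.
    by rewrite -DCi; case/setUP: bD => ->; rewrite ?orbT.
  by move/(ltn_trans jb); rewrite ltnn.
have ctx_add z b D : b \in D1 :|: D2 ->
    [disjoint ctx T z b & D] -> [disjoint ctx T z b & j |: D].
  move=> bD dis; apply: disjoint_pointwise => i ib /setU1P[ij|iD].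
    by rewrite ij (negPf (ctx_new z b bD)) in ib.
  by rewrite (disjointFr dis ib) in iD.
have sep1' z : agree C z x -> forall b, b \in D1 -> [disjoint ctx T z b & D2].
  by move=> zx b; apply: sep1.
have sep2' z : agree C z x -> forall b, b \in D2 -> [disjoint ctx T z b & D1].
  by move=> zx b; apply: sep2.
have add1 D D' : j \notin D' -> [disjoint D & D'] -> [disjoint j |: D & D'].
  move=> jD dis; apply: disjoint_pointwise => i /setU1P[->|iD] iD'.
    by rewrite iD' in jD.
  by rewrite (disjointFr dis iD) in iD'.
(* A one-state [j] goes to [C], since perfectness will be applied to indices of [D1] and [D2], which
   must have at least two states. *)
have condition : ~~ (1 < d j)%N -> J T (CSI D1 D2 set0 (proj (j |: C) x)) ->
    exists D1' D2' C', separates x k j.+1 D1' D2' C'.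
  move=> dj Jj; exists D1, D2, (j |: C); split => //.
  - by rewrite beforeS -DC setUCA.
  - by rewrite disjoint_sym add1 // disjoint_sym.
  - by rewrite disjoint_sym add1 // disjoint_sym.
  - by move=> i /setU1P[->|/Ctriv //]; right.
  - by move=> z b; rewrite agree_setU => /andP[_ zx]; exact: sep1.
  - by move=> z b; rewrite agree_setU => /andP[_ zx]; exact: sep2.
(* Otherwise [j] joins the side that its context may meet. *)
have [dis|dis] := ctx_dichotomy DC d12 d1C d2C nontriv sep1' sep2'.
- have Jj := J_extend DC d12 d1C d2C dis JD.
  have [dj|dj] := boolP (1 < d j)%N; last by apply: condition => //; exact: J_condition.
  exists (j |: D1), D2, C; split=> //; rewrite ?add1 //.
  + by rewrite beforeS -DC !setUA.
  + by rewrite inE kD orbT.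
  + by move=> i /setU1P[->|/Dk //]; exact: ltnW.
  + by move=> i; rewrite -setUA => /setU1P[->//|/nontriv].
  + by move=> z b zx /setU1P[->|bD]; [exact: dis|exact: sep1].
  + by move=> z b zx bD; apply: ctx_add; [rewrite inE bD orbT|exact: sep2].
- have DC' : D2 :|: D1 :|: C = before p j by rewrite -DC (setUC D1).
  have d21 : [disjoint D2 & D1] by rewrite disjoint_sym.
  have Jj := J_extend DC' d21 d2C d1C dis (csi_symmetry JD).
  have [dj|dj] := boolP (1 < d j)%N; last first.
    by apply: condition => //; apply: csi_symmetry; exact: J_condition.
  exists D1, (j |: D2), C; split=> //; rewrite ?add1 //.
  + by rewrite beforeS -DC setUCA !setUA.
  + by rewrite disjoint_sym add1 .
  + by move=> i; rewrite setUCA => /setU1P[->//|/nontriv].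
  + by move=> z b zx bD; apply: ctx_add; [rewrite inE bD|exact: sep1].
  + by move=> z b zx /setU1P[->|bD]; [exact: dis|exact: sep2].
  + exact: csi_symmetry.
Qed.

Lemma separation x k m : (1 < d k)%N -> (k < m <= p)%N ->
  exists D1 D2 C, separates x k m D1 D2 C.
Proof.
move=> dk; elim: m => // m IH /andP[]; rewrite ltnS leq_eqVlt => /predU1P[<- _|km mp].
  by do 3!eexists; exact: separation_base.
case: IH => [|D1 [D2 [C S]]]; first by rewrite km ltnW.
exact: (@separation_step x (Ordinal mp)) S.
Qed.

(** Once all variables are placed, the separation is saturated. [D1] contains [k] and nothing
    earlier, so exchanging its coordinates changes the state at [k] and keeps the prefix. *)
Lemma saturated_move x y k : agree (ctx T x k) x y -> x k != y k ->
  exists x' y' : outcome d, [/\ agree (before p k) x' x, x' k = y k &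
    exists st, Sat T st /\
      csi_poly st (pvar R x * pvar R y - pvar R x' * pvar R y')].
Proof.
move=> xy xyk.
have dk : (1 < d k)%N by apply: contraNT xyk => dk; apply/eqP/ord_eq1.
have [|D1 [D2 [C [DC d12 d1C d2C kD Dk Ctriv nontriv sep1 sep2 JD]]]] :=
  @separation x k p dk; first by rewrite ltn_ord leqnn.
have beforeT : before p p = setT by apply/setP => i; rewrite !inE ltn_ord.
have agreeC : agree C x y.
  apply/agreeP => i /Ctriv[ic|di]; last exact: ord_eq1.
  by move/agreeP: xy; exact.
exists (mix D1 y x), (mix D2 y x); split.
- apply: agree_mix_out; apply: disjoint_pointwise => i; rewrite inE => ik /Dk.
  by rewrite leqNgt ik.
- by rewrite mix_in.
exists (CSI D1 D2 set0 (proj C x)); split.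
  by split=> //; rewrite /saturated /= setU0 dom_proj DC.
(* As [x] and [y] agree on [C], overwriting [x] by [y] on [D1] and [D2] gives [y]. *)
exists x, y; rewrite /= dom_proj; split=> //; congr (_ * pvar R _ - _).
  apply/ffunP => i; rewrite ffunE; case: ifP => // iD.
  have : i \in before p p by rewrite beforeT inE.
  by rewrite -DC inE iD /= => iC; apply/esym; move/agreeP: agreeC; exact.
exact: mulrC.
Qed.

End SaturatedMoves.

(** * Soundness of the CSI axioms *)

Section Marginals.
Variables (R : realType) (p : nat) (d : 'I_p -> nat) (P : outcome d -> R).
Implicit Types (x y z : outcome d) (A B C D U W : {set 'I_p}).

Definition marg U x : R := \sum_(z | agree U z x) P z.

Lemma marg_agree U x y : agree U x y -> marg U x = marg U y.
Proof.
move=> xy; apply: eq_bigl => z; apply/idP/idP => h; apply: agree_trans h _ => //.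
by rewrite agree_sym.
Qed.

Lemma marg_setT x : marg setT x = P x.
Proof. by rewrite /marg (big_pred1 x) // => z; rewrite agree_setT. Qed.

Lemma sum_marg U D x : [disjoint U & D] ->
  \sum_(y | agree (~: D) y x) marg (U :|: D) y = marg U x.
Proof.
move=> UD; have DC : [disjoint ~: D & D].
  by apply: disjoint_pointwise => i; rewrite inE => /negPf ->.
(* The terms on the right are grouped by their coordinates in [D]. *)
rewrite /marg [RHS](partition_big (fun z => mix D z x)
  (fun y => agree (~: D) y x)) /=; last by move=> z _; exact: agree_mix_out.
apply: eq_bigr => y yx; apply: eq_bigl => z; rewrite agree_setU.
have yU : agree U y x.
  by apply: agree_sub yx; rewrite -disjoints_subset.
have -> : agree U z y = agree U z x.
  by apply/idP/idP => h; apply: agree_trans h _; rewrite // agree_sym.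
congr (_ && _); apply/idP/eqP => [zy|<-]; last by rewrite agree_sym agree_mix_in.
apply/ffunP => i; rewrite ffunE; case: ifP => iD; first exact: agree_at zy _.
by apply/esym/(agree_at yx); rewrite inE iD.
Qed.

(** Conditional independence at one outcome, cross-multiplied so that neither division nor a total
    mass of 1 is involved. *)
Definition ci A B W x :=
  marg (A :|: B :|: W) x * marg W x = marg (A :|: W) x * marg (B :|: W) x.

Hypothesis P_gt0 : forall x, 0 < P x.

Lemma marg_gt0 U x : 0 < marg U x.
Proof.
rewrite /marg (bigD1 x) ?agree_refl //= ltr_wpDr //.
by apply: sumr_ge0 => z _; exact: ltW.
Qed.

Lemma marg_neq0 U x : marg U x != 0.
Proof. by rewrite gt_eqF ?marg_gt0. Qed.

Lemma ci_symmetry A B W x : ci A B W x -> ci B A W x.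
Proof. by rewrite /ci (setUC B A) => ->; rewrite mulrC. Qed.

(** The premise is summed over the coordinates in [D]; one factor on each side does not depend on
    them. *)
Lemma ci_decomposition A B D W x : [disjoint A :|: B :|: W & D] ->
  (forall y, agree (~: D) y x -> ci A (B :|: D) W y) -> ci A B W x.
Proof.
move=> dis H; have sub U y : U \subset A :|: B :|: W -> agree (~: D) y x -> marg U y = marg U x.
  move=> UAB yx; apply: marg_agree; apply: agree_sub yx.
  by rewrite -disjoints_subset; exact: disjointWl dis.
have eqy y : agree (~: D) y x -> marg (A :|: B :|: W :|: D) y * marg W x =
    marg (A :|: W) x * marg (B :|: W :|: D) y.
  move=> yx; rewrite -(sub W y) ?subsetUr // -(sub (A :|: W) y) ?setSU ?subsetUl //.
  by rewrite setUAC -(setUA A) (setUAC B W) H.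
have : \sum_(y | agree (~: D) y x) _ = \sum_(y | agree (~: D) y x) _ := eq_bigr _ eqy.
rewrite -mulr_suml -mulr_sumr !sum_marg //.
by apply: disjointWl dis; rewrite setSU ?subsetUr.
Qed.

Lemma ci_weak_union A B D W x :
  ci A (B :|: D) W x -> ci A D W x -> ci A B (D :|: W) x.
Proof.
rewrite /ci !setUA => h1 h2; apply: (mulIf (marg_neq0 W x)).
rewrite mulrAC h1 [RHS]mulrAC h2; exact: mulrAC.
Qed.

Lemma ci_contraction A B D W x :
  ci A B (D :|: W) x -> ci A D W x -> ci A (B :|: D) W x.
Proof.
rewrite /ci !setUA => h1 h2; apply: (mulIf (marg_neq0 (D :|: W) x)).
rewrite mulrAC h1 mulrAC h2; exact: mulrAC.
Qed.

(** Positivity allows the marginal on [B], [S], [W] to be cancelled between the premises. Summing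
    over [B] then gives independence of [A] and [S] given [W], and contraction finishes. *)
Lemma ci_intersection A B S W x : [disjoint A :|: S :|: W & B] ->
  (forall y, agree (~: B) y x -> ci A B (S :|: W) y) ->
  (forall y, agree (~: B) y x -> ci A S (B :|: W) y) -> ci A (B :|: S) W x.
Proof.
move=> dis H1 H2; apply: ci_contraction; first exact/H1/agree_refl.
have sub U y : U \subset A :|: S :|: W -> agree (~: B) y x -> marg U y = marg U x.
  move=> UAS yx; apply: marg_agree; apply: agree_sub yx.
  by rewrite -disjoints_subset; exact: disjointWl dis.
have eqy y : agree (~: B) y x -> marg (A :|: S :|: W) x * marg (W :|: B) y =
    marg (S :|: W) x * marg (A :|: W :|: B) y.
  move=> yx; have SW : S :|: W \subset A :|: S :|: W by rewrite -setUA subsetUr.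
  have := H1 y yx; have := H2 y yx; rewrite /ci !setUA.
  rewrite -(sub (A :|: S :|: W) y) // -(sub (S :|: W) y) //.
  rewrite (setUC W B) (setUAC A W) (setUAC A S) (setUC S B) => h2 h1.
  apply: (mulIf (marg_neq0 (B :|: S :|: W) y)).
  by rewrite mulrAC -h1 mulrAC h2; ring.
have : \sum_(y | agree (~: B) y x) _ = \sum_(y | agree (~: B) y x) _ := eq_bigr _ eqy.
rewrite -!mulr_sumr !sum_marg //.
- by rewrite /ci => ->; exact: mulrC.
- by apply: disjointWl dis; rewrite setSU // subsetUl.
- by apply: disjointWl dis; rewrite subsetUr.
Qed.

(** On full outcomes independence factors [P z * marg W x] into marginals on [A], [W] and on [B],
    [W]. Exchanging coordinates only permutes these factors. *)
Lemma ci_saturated A B W x y : A :|: B :|: W = setT ->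
    [disjoint A & B] -> [disjoint A & W] -> [disjoint B & W] ->
    (forall z, agree W z x -> ci A B W z) ->
  P x * P (mix (A :|: B) y x) = P (mix B y x) * P (mix A y x).
Proof.
move=> ABW dAB dAW dBW H.
have H' z : agree W z x -> P z * marg W x = marg (A :|: W) z * marg (B :|: W) z.
  by move=> zx; have := H z zx; rewrite /ci ABW marg_setT (marg_agree zx).
have agrW D : [disjoint D & W] -> agree W (mix D y x) x.
  by move=> dis; rewrite agree_mix_out // disjoint_sym.
have dABW : [disjoint A :|: B & W].
  by apply: disjoint_pointwise => i /setUP[] iA; rewrite ?(disjointFr dAW iA) ?(disjointFr dBW iA).
have mE U D D' : (forall i, i \in U -> i \notin W -> (i \in D) = (i \in D')) ->
    agree W (mix D y x) x -> agree W (mix D' y x) x ->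
    marg (U :|: W) (mix D y x) = marg (U :|: W) (mix D' y x).
  move=> UD Dx D'x; apply: marg_agree; apply/agreeP => i; rewrite inE => iUW.
  have [iW|iW] := boolP (i \in W); first by rewrite (agree_at Dx) // (agree_at D'x).
  by rewrite (negPf iW) orbF in iUW; rewrite !ffunE (UD i).
have nA i : i \in A -> i \in B = false by apply: disjointFr.
have nB i : i \in B -> i \in A = false by apply: disjointFl.
have mix0 : x = mix set0 y x by apply/ffunP => i; rewrite ffunE inE.
have ag1 : agree W (mix (A :|: B) y x) x by exact: agrW.
have ag2 : agree W (mix B y x) x by exact: agrW.
have ag3 : agree W (mix A y x) x by exact: agrW.
have ag0 : agree W (mix set0 y x) x by rewrite -mix0 agree_refl.
have eA : marg (A :|: W) (mix (A :|: B) y x) = marg (A :|: W) (mix A y x).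
  by apply: mE => // i iA _; rewrite inE iA.
have eA0 : marg (A :|: W) (mix B y x) = marg (A :|: W) x.
  by rewrite [in RHS]mix0; apply: mE => // i iA _; rewrite inE nA.
have eB : marg (B :|: W) (mix (A :|: B) y x) = marg (B :|: W) (mix B y x).
  by apply: mE => // i iB _; rewrite inE iB orbT.
have eB0 : marg (B :|: W) (mix A y x) = marg (B :|: W) x.
  by rewrite [in RHS]mix0; apply: mE => // i iB _; rewrite inE nB.
apply: (mulIf (marg_neq0 W x)); apply: (mulIf (marg_neq0 W x)).
set w := marg W x.
transitivity ((P x * w) * (P (mix (A :|: B) y x) * w)); first by ring.
transitivity ((P (mix B y x) * w) * (P (mix A y x) * w)); last by ring.
rewrite !H' ?agree_refl // eA eA0 eB eB0; ring.
Qed.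

End Marginals.

(** * Induction over the CSI axioms *)

Section Soundness.
Variables (R : realType) (p : nat) (d : 'I_p -> nat) (P : outcome d -> R).
Hypothesis d_gt0 : forall i, (0 < d i)%N.
Hypothesis P_gt0 : forall x, 0 < P x.
Implicit Types (x y z : outcome d) (A B C D U W S : {set 'I_p}) (c : poutcome d).

#[local] Arguments pairwise_disjoint {p} As : simpl never.

(** Disjointness is part of the invariant because some axioms only inherit it from their
    premises. *)
Definition satisfies (st : csi d) : Prop :=
  pairwise_disjoint [:: csiA st; csiB st; csiS st; dom (csic st)] /\
  forall x, proj (dom (csic st)) x = csic st ->
    ci P (csiA st) (csiB st) (csiS st :|: dom (csic st)) x.

Lemma dom_comb b c : dom (comb b c) = dom b :|: dom c.
Proof. by apply/setP => i; rewrite !inE ffunE; case: (b i). Qed.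

Lemma proj_domP c x : proj (dom c) x = c <-> (forall i s, c i = Some s -> x i = s).
Proof.
split=> [<- i s|H]; first by rewrite ffunE; case: ifP => // _ [].
by apply/ffunP => i; rewrite ffunE inE; case E: (c i) => //=; rewrite (H i _ E).
Qed.

Lemma proj_dom_agree U c x y : dom c \subset U -> agree U y x ->
  proj (dom c) x = c -> proj (dom c) y = c.
Proof.
by move=> cU yx {2}<-; apply/eqP; rewrite proj_agree; apply: agree_sub yx.
Qed.

Lemma pairwise_disjoint_count_le1 (As : seq {set 'I_p}) i : pairwise_disjoint As ->
  (count (fun A : {set 'I_p} => i \in A) As <= 1)%N.
Proof.
rewrite /pairwise_disjoint; elim: As => //= A As IH /andP[/allP dA /IH].
have [iA _|//] := boolP (i \in A).
rewrite (_ : count _ _ = 0%N) //; apply/eqP; rewrite eqn0Ngt -has_count.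
by apply/hasPn => B /dA /disjointFr ->.
Qed.

Local Ltac disjoint_from pd :=
  (apply: disjoint_pointwise || apply: pairwise_disjoint_count);
  let i := fresh "i" in intro i; generalize (pairwise_disjoint_count_le1 i pd); rewrite /= !inE;
  repeat match goal with |- context [i \in ?A] => case: (i \in A) end;
  repeat match goal with |- context [isSome ?A] => case: (isSome A) end.

Lemma satisfies_closure (G : csi d -> Prop) st :
  (forall st, G st -> satisfies st) -> csi_closure G st -> satisfies st.
Proof.
move=> GS; elim=> {st} [st /GS //|A B S c _ [/= pd IH]|A B D S c /= pd _ [/= _ IH]|
  A B D S c /= pd _ [/= _ IH]|A B D S c /= pd _ [/= _ IH1] _ [/= _ IH2]|
  A B D S c /= pd _ [/= _ IH1] _ [/= _ IH2]|A B S c U t _ [/= pd IH] US tU|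
  A B S C U c UC cC _ IH].
- split=> /=; last by move=> x /IH; exact: ci_symmetry.
  by apply: pairwise_disjoint_count => i; have := pairwise_disjoint_count_le1 i pd; rewrite /= addnCA.
- have disD : [disjoint A :|: B :|: (S :|: dom c) & D] by disjoint_from pd.
  split=> [|x /= xc]; first by disjoint_from pd.
  apply: (ci_decomposition disD) => y yx; apply: IH; apply: proj_dom_agree yx xc.
  by rewrite -disjoints_subset; disjoint_from pd.
- have disB : [disjoint A :|: D :|: (S :|: dom c) & B] by disjoint_from pd.
  split=> [|x /= xc]; first by disjoint_from pd.
  rewrite (setUC S) -setUA; apply: (ci_weak_union P_gt0); first exact: IH.
  apply: (ci_decomposition disB) => y yx; rewrite (setUC D B); apply: IH.
  apply: proj_dom_agree yx xc.
  by rewrite -disjoints_subset; disjoint_from pd.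
- split=> [|x /= xc]; first by disjoint_from pd.
  apply: (ci_contraction P_gt0); last exact: IH2.
  by rewrite setUA (setUC D); exact: IH1.
- have disB : [disjoint A :|: S :|: (D :|: dom c) & B] by disjoint_from pd.
  split=> [|x /= xc]; first by disjoint_from pd.
  apply: (ci_intersection P_gt0 disB) => y yx; rewrite setUA.
    apply: IH1; apply: proj_dom_agree yx xc.
    by rewrite -disjoints_subset; disjoint_from pd.
  apply: IH2; apply: proj_dom_agree yx xc.
  by rewrite -disjoints_subset; disjoint_from pd.
(* Specialization keeps the union of [S] and the context, so the equation is unchanged and only
   required at fewer outcomes. *)
- have tUS i : t i -> i \in S by rewrite -(in_set (fun i => t i)) -/(dom t) tU; exact: (subsetP US).
  have dE : S :\: U :|: dom (comb t c) = S :|: dom c.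
    rewrite dom_comb tU setUA; congr (_ :|: _); apply/setP => i; rewrite !inE.
    by case: (boolP (i \in U)) => [/(subsetP US) ->|]; rewrite ?orbF.
  split=> [|x /= /proj_domP xc].
    apply: pairwise_disjoint_count => i; have := pairwise_disjoint_count_le1 i pd; have := tUS i.
    rewrite /= dom_comb !inE -tU inE; case: (isSome (t i)) => [/(_ isT) ->|_] //.
    by case: (i \in A); case: (i \in B); case: (isSome (c i)).
  rewrite dE; apply: IH; apply/proj_domP => i s ci; apply: xc; rewrite ffunE.
  have := pairwise_disjoint_count_le1 i pd; rewrite /= !inE ci.
  have := tUS i; case: (t i) => // u /(_ isT) ->.
  by case: (i \in A); case: (i \in B).
(* Absorption: an outcome [x] extending [c] falls under the premise for its own restriction to
   [U]. *)
- have inst x : proj (dom c) x = c -> [/\ comb c (proj U x) = proj (dom c :|: U) x &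
     dom (comb c (proj U x)) = dom c :|: U].
    move=> xc; split; last by rewrite dom_comb dom_proj.
    by rewrite -[in LHS]xc comb_proj.
  split=> [|x /= xc].
    (* Nonempty state spaces provide at least one premise from which to read off disjointness. *)
    have [x xc] := poutcome_extends d_gt0 c; have [_ dE] := inst x xc.
    have [pd _] := IH (proj U x) (dom_proj _ _).
    rewrite /= dE in pd; apply: pairwise_disjoint_count => i.
    have := pairwise_disjoint_count_le1 i pd; rewrite cC /= !inE.
    by case: (i \in A); case: (i \in B); case: (i \in S); case: (i \in U); case: (i \in C).
  have [pE dcE] := inst x xc.
  have [_ /= H] := IH (proj U x) (dom_proj _ _).
  by have := H x; rewrite dcE pE (setUC (dom c)) setUA; apply.
Qed.

End Soundness.

(** * Distributions given by edge labels *)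

Section Weights.
Variables (R : realType) (p : nat) (d : 'I_p -> nat) (L : finType).
Variable T : staged_tree d L.
Implicit Types (x y : outcome d) (i k l : 'I_p) (z : R) (rho tau : L -> R).

Definition weight z rho x : R := z * \prod_l rho (lab T x l).

Definition normalized_from (m : nat) rho :=
  forall x k, (m <= k)%N -> \sum_(s < d k) rho (lab T (upd x s) k) = 1 :> R.

Lemma weight_gt0 z rho x : 0 < z -> (forall e, 0 < rho e) -> 0 < weight z rho x.
Proof. by move=> z0 r0; rewrite mulr_gt0 // prodr_gt0. Qed.

Lemma sum_upd x k (F : outcome d -> R) :
  \sum_(y | agree (~: [set k]) y x) F y = \sum_(s < d k) F (upd x s).
Proof.
rewrite (reindex (fun s : 'I_(d k) => upd x s)) /=.
  apply: eq_bigl => s; apply/agreeP => i; rewrite !inE => ik; exact: upd_neq.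
exists (fun y => y k) => [s _|y yx]; first exact: upd_eq.
apply/ffunP => i; have [->|ik] := eqVneq i k; first by rewrite upd_eq.
by rewrite upd_neq // (agree_at yx) // !inE.
Qed.

Hypothesis hT : CStree T.

Lemma lab_agree x y k : agree (before p k.+1) x y -> lab T x k = lab T y k.
Proof.
move=> xy; apply/eqP; rewrite lab_eq // (agree_at xy) ?inE // eqxx andbT.
by apply: agree_sub xy; apply/subsetP => i /ctx_lt; rewrite inE; exact: leqW.
Qed.

Section Normalized.
Variables (z : R) (rho : L -> R).
Hypotheses (z_gt0 : 0 < z) (rho_gt0 : forall e, 0 < rho e).
Hypothesis rho_norm : normalized_from 0 rho.
Let P := weight z rho.

Lemma marg_before m x : (m <= p)%N ->
  marg P (before p m) x = z * \prod_(l < p | (l < m)%N) rho (lab T x l).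
Proof.
(* Induction on the number [n] of final levels summed out: each summation removes one level, whose
   labels sum to 1. *)
move=> mp; rewrite -(subKn mp); move: (p - m)%N (leq_subr m p) x => n.
elim: n => [_|n IH np] x.
  rewrite subn0; have -> : before p p = setT by apply/setP => i; rewrite !inE ltn_ord.
  by rewrite marg_setT; congr (_ * _); apply: eq_bigl => l; rewrite ltn_ord.
pose k := Ordinal (rev_ord_proof (Ordinal np)).
have kS : (p - n)%N = k.+1 by rewrite /= -subSn ?subSS.
have -> : (p - n.+1)%N = k by [].
have := IH (ltnW np); rewrite kS => {}IH.
have dis : [disjoint before p k & [set k]].
  by apply: disjoint_pointwise => i; rewrite !inE => ik /eqP e; rewrite e ltnn in ik.
rewrite -(sum_marg P x dis) sum_upd.
have -> : before p k :|: [set k] = before p k.+1.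
  by apply/setP => i; rewrite !inE orbC ltnS [RHS]leq_eqVlt.
rewrite -[RHS]mulr1 -[X in _ = _ * X](rho_norm x (leq0n k)) mulr_sumr; apply: eq_bigr => s _.
rewrite IH -!mulrA; congr (_ * _).
rewrite (bigD1 k) //= mulrC; congr (_ * _).
apply: eq_big => l; first by rewrite ltnS ltn_neqAle andbC.
move=> /andP[lk lnk]; congr rho; apply: lab_agree; apply/agreeP => i; rewrite inE => il.
by apply: upd_lt; apply: leq_trans il _; rewrite ltn_neqAle lnk.
Qed.

(** The label at [k] depends only on the context and the state, so it factors out of the sum over
    the remaining past coordinates. *)
Lemma stage_satisfies k (v : level d k) : satisfies P (stage_statement T v).
Proof.
have [x ->] := level_anc (state_gt0 T) v; rewrite stage_statement_anc; split=> [|y /=].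
  apply: pairwise_disjoint_count => i; rewrite dom_proj /= !inE.
  have := introT implyP (@ctx_lt _ _ _ T x k i); move: (eq_ltnF i k).
  by case: (i == k); case: (i < k)%N; case: (i \in ctx T x k).
rewrite dom_proj => /eqP; rewrite proj_agree agree_sym => xy.
rewrite {}(ctx_eq hT xy) set0U => {x xy}; set K := ctx T y k; set D := before p k :\: K.
have KD : K :|: D = before p k
    by apply/setP => i; rewrite !inE; case: (boolP (i \in K)) => [/ctx_lt ->|].
have beforeS : before p k.+1 = [set k] :|: before p k.
  by apply/setP => i; rewrite !inE ltnS leq_eqVlt.
have margS x : marg P (before p k.+1) x = marg P (before p k) x * rho (lab T x k).
  rewrite !marg_before ?ltn_ord ?(ltnW (ltn_ord k)) // -mulrA; congr (_ * _).
  rewrite (bigD1 k) //= mulrC; congr (_ * _); apply: eq_bigl => l.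
  by rewrite ltnS [RHS]ltn_neqAle andbC.
have margK : marg P ([set k] :|: K) y = marg P K y * rho (lab T y k).
  have dis1 : [disjoint [set k] :|: K & D].
    apply: disjoint_pointwise => i; rewrite !inE => /orP[/eqP ->|->//].
    by rewrite ltnn andbF.
  have dis2 : [disjoint K & D] by apply: disjointWl dis1; exact: subsetUr.
  rewrite -(sum_marg P y dis1) -(sum_marg P y dis2) mulr_suml; apply: eq_bigr => x xy.
  rewrite -setUA KD -beforeS margS; congr (_ * rho _); apply/eqP.
  have xy' (U : {set 'I_p}) : [disjoint U & D] -> agree U x y.
    by move=> dis; apply: agree_sub xy; rewrite -disjoints_subset.
  rewrite eq_sym lab_eq // agree_sym xy' //= (agree_at (xy' _ dis1)) //.
  by rewrite !inE eqxx.
have DK : D :|: K = before p k by rewrite setUC.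
rewrite /ci -setUA DK -beforeS margS margK; ring.
Qed.

Lemma J_satisfies st : J T st -> satisfies P st.
Proof.
have P_gt0 x : 0 < P x by exact: weight_gt0.
apply: satisfies_closure => //; first exact: state_gt0 T.
by move=> _ [k [v ->]]; exact: stage_satisfies.
Qed.

End Normalized.

Definition ev z rho : prob_ring R d -> R :=
  meval (fun j => weight z rho (enum_val j)).

Lemma ev_pvar z rho x : ev z rho (pvar R x) = weight z rho x.
Proof. by rewrite /ev mevalXU enum_rankK. Qed.

Lemma ev_csi_poly z rho st f : 0 < z -> (forall e, 0 < rho e) ->
  normalized_from 0 rho -> Sat T st -> csi_poly st f -> ev z rho f = 0.
Proof.
move=> z0 r0 rn [/(J_satisfies z0 r0 rn)[pd H] sat] [x [y [xc ->]]].
rewrite /ev mevalB !mevalM -!/(ev _ _ _) !ev_pvar; apply/eqP; rewrite subr_eq0; apply/eqP.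
have P_gt0 u : 0 < weight z rho u by exact: weight_gt0.
have dis i := pairwise_disjoint_count_le1 i pd.
apply: (ci_saturated P_gt0 (W := csiS st :|: dom (csic st))).
- by rewrite setUA.
- apply: disjoint_pointwise => i iA iB; have := dis i.
  by rewrite /= iA iB.
- apply: disjoint_pointwise => i iA; have := dis i; rewrite /= iA in_setU.
  by case: (i \in csiS st); case: (i \in dom (csic st)); case: (i \in csiB st).
- apply: disjoint_pointwise => i iB; have := dis i; rewrite /= iB in_setU.
  by case: (i \in csiS st); case: (i \in dom (csic st)); case: (i \in csiA st).
- move=> u ux; apply: H; apply: proj_dom_agree ux xc; exact: subsetUr.
Qed.

End Weights.

(** * Normalization of the labels *)

Section Normalization.
Variables (R : realType) (p : nat) (d : 'I_p -> nat) (L : finType).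
Variable T : staged_tree d L.
Hypothesis hT : CStree T.
Hypothesis hbal : balanced R T.
Implicit Types (x y : outcome d) (i k l : 'I_p) (z : R) (rho tau : L -> R).

Section Step.
Variables (k : 'I_p) (tau : L -> R).
Hypothesis tau_gt0 : forall e, 0 < tau e.

Definition stage_sum x : R := \sum_(s < d k) tau (lab T (upd x s) k).

Definition top_ctx x l :=
  [&& l \in ctx T x k, (1 < d l)%N &
      [forall i in ctx T x k, (1 < d i)%N ==> (i <= l)%N]].

Lemma stage_sum_gt0 x : 0 < stage_sum x.
Proof.
rewrite /stage_sum (bigD1 (Ordinal (state_gt0 T k))) //= ltr_wpDr //.
by apply: sumr_ge0 => s _; exact: ltW.
Qed.

Lemma ctx_upd x (s : 'I_(d k)) : ctx T (upd x s) k = ctx T x k.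
Proof.
apply/esym/(ctx_eq hT)/agreeP => i /ctx_lt ik; exact/esym/upd_lt.
Qed.

Lemma stage_sum_ctx x y : agree (ctx T x k) x y -> stage_sum x = stage_sum y.
Proof.
move=> xy; apply: eq_bigr => s _; congr tau; apply/eqP.
rewrite lab_eq // ctx_upd !upd_eq eqxx andbT; apply/agreeP => i ic.
by rewrite !upd_lt ?(ctx_lt ic) // (agree_at xy).
Qed.

(* If [l] is the last nontrivial index of the context of [x] at [k], then by
   perfectness this context is contained in that of [x] at [l], up to [l]
   itself and trivial indices; so the label of [x] at [l] determines it. *)
Lemma top_ctx_lab x y l : top_ctx x l -> lab T x l = lab T y l ->
  agree (ctx T x k) x y.
Proof.
case/and3P=> lc dl /forall_inP ltop /eqP; rewrite lab_eq // => /andP[xy /eqP xyl].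
apply/agreeP => i ic; have [di|] := boolP (1 < d i)%N; last exact: ord_eq1.
have := implyP (ltop i ic) di; rewrite leq_eqVlt => /predU1P[/val_inj ->//|il].
apply: (agree_at xy); exact: (ctx_perfect hT hbal lc).
Qed.

Lemma top_ctx_uniq x l m : top_ctx x l -> top_ctx x m -> l = m.
Proof.
case/and3P=> lc dl /forall_inP ltop /and3P[mc dm /forall_inP mtop].
apply/val_inj/eqP; rewrite eqn_leq.
by rewrite (implyP (ltop m mc) dm) (implyP (mtop l lc) dl).
Qed.

Lemma top_ctx_exists x i : i \in ctx T x k -> (1 < d i)%N -> exists l, top_ctx x l.
Proof.
move=> ic di; pose Q l := (l \in ctx T x k) && (1 < d l)%N.
have Qi : Q i by rewrite /Q ic.
case: (arg_maxnP (fun l : 'I_p => l : nat) Qi) => l /andP[lc dl] lmax.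
exists l; rewrite /top_ctx lc dl; apply/forall_inP => m mc; apply/implyP => dm.
by apply: lmax; rewrite /Q mc.
Qed.

Lemma top_ctx_agree x y l : agree (ctx T x k) x y -> top_ctx x l -> top_ctx y l.
Proof. by move=> /(ctx_eq hT) e; rewrite /top_ctx e. Qed.

(* The factors by which labels of levels below [k] absorb the stage sums. *)
Definition pushed e : R :=
  if [pick x | [exists l, top_ctx x l && (lab T x l == e)]] is Some x
  then stage_sum x else 1.

Definition divided e : R :=
  if [pick x | lab T x k == e] is Some x then (stage_sum x)^-1 else 1.

(** The choice made by [pick] is harmless: outcomes with this label at their top index agree on the
    context at [k]. *)
Lemma pushed_top x l : top_ctx x l -> pushed (lab T x l) = stage_sum x.
Proof.
move=> xl; rewrite /pushed; case: pickP => [y /existsP[m /andP[ym /eqP e]]|/(_ x)].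
  have ml := lab_level hT e; subst m.
  by apply: stage_sum_ctx; exact: top_ctx_lab ym e.
by move/existsP; case; exists l; rewrite xl eqxx.
Qed.

Lemma pushed_not_top x l : ~~ top_ctx x l -> pushed (lab T x l) = 1.
Proof.
move=> xl; rewrite /pushed; case: pickP => // y /existsP[m /andP[ym /eqP e]].
have ml := lab_level hT e; subst m.
by case/negP: xl; apply: (top_ctx_agree _ ym); exact: top_ctx_lab ym e.
Qed.

Lemma divided_eq x : divided (lab T x k) = (stage_sum x)^-1.
Proof.
rewrite /divided; case: pickP => [y|/(_ x)]; last by rewrite eqxx.
by rewrite lab_eq // => /andP[xy _]; rewrite (stage_sum_ctx xy).
Qed.

Lemma divided_neq x l : l != k -> divided (lab T x l) = 1.
Proof.
move=> lk; rewrite /divided; case: pickP => // y /eqP /(lab_level hT) kl.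
by rewrite kl eqxx in lk.
Qed.

Lemma pushed_gt0 e : 0 < pushed e.
Proof. by rewrite /pushed; case: pickP => // x _; exact: stage_sum_gt0. Qed.

Lemma divided_gt0 e : 0 < divided e.
Proof. by rewrite /divided; case: pickP => // x _; rewrite invr_gt0 stage_sum_gt0. Qed.

(** If some context at [k] has only one-state variables, level [k] is a single stage and no label
    can absorb its sum; the scale factor [z] does. *)
Definition pushed_const : R :=
  if [pick x | [forall l, ~~ top_ctx x l]] is Some x then stage_sum x else 1.

Lemma pushed_const_gt0 : 0 < pushed_const.
Proof. by rewrite /pushed_const; case: pickP => // x _; exact: stage_sum_gt0. Qed.

(** There is one carrier of the stage sum: the label at the top index if there is such an index, and
    the constant otherwise. *)
Lemma prod_pushed x :
  pushed_const * \prod_l pushed (lab T x l) = stage_sum x.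
Proof.
rewrite /pushed_const; case: pickP => [y /forallP ny|/(_ x)].
  have yx : agree (ctx T y k) y x.
    apply/agreeP => i ic; have [di|] := boolP (1 < d i)%N; last exact: ord_eq1.
    by have [l yl] := top_ctx_exists ic di; have := ny l; rewrite yl.
  have xy : agree (ctx T x k) x y by rewrite -(ctx_eq hT yx) agree_sym.
  rewrite big1 ?mulr1 ?(stage_sum_ctx yx) // => l _; apply: pushed_not_top.
  by apply: contra (ny l); exact: top_ctx_agree.
move/negbT; rewrite negb_forall => /existsP[l /negPn xl].
rewrite mul1r (bigD1 l) //= pushed_top // big1 ?mulr1 // => m ml.
apply: pushed_not_top; apply: contra ml => xm; apply/eqP; exact: top_ctx_uniq xm xl.
Qed.

Definition rescaled e := tau e * pushed e * divided e.

Lemma rescaled_gt0 e : 0 < rescaled e.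
Proof. by rewrite !mulr_gt0 ?pushed_gt0 ?divided_gt0. Qed.

Lemma weight_rescaled z x : weight T z tau x = weight T (z * pushed_const) rescaled x.
Proof.
have prod_divided : \prod_l divided (lab T x l) = (stage_sum x)^-1.
  by rewrite (bigD1 k) //= divided_eq big1 ?mulr1 // => l; exact: divided_neq.
rewrite /weight /rescaled !big_split /= prod_divided -(prod_pushed x).
have Sx : pushed_const * \prod_l pushed (lab T x l) != 0.
  by rewrite prod_pushed gt_eqF ?stage_sum_gt0.
by field; move: Sx; rewrite mulf_eq0 negb_or => /andP[-> ->].
Qed.

(** Absorbing labels lie on levels before [k], so later levels keep their sums while level [k] is
    divided by its own. *)
Lemma rescaled_normalized :
  normalized_from T k.+1 tau -> normalized_from T k rescaled.
Proof.
move=> norm x l; rewrite leq_eqVlt => /predU1P[/val_inj <-|kl].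
  rewrite (eq_bigr (fun s : 'I_(d k) => tau (lab T (upd x s) k) / stage_sum x)).
    by rewrite -mulr_suml divff // gt_eqF ?stage_sum_gt0.
  move=> s _; rewrite /rescaled divided_eq pushed_not_top ?mulr1.
    congr (_ / _); apply: stage_sum_ctx; rewrite ctx_upd; apply/agreeP => i /ctx_lt.
    exact: upd_lt.
  by apply/negP => /and3P[/ctx_lt]; rewrite ltnn.
rewrite -(norm x l kl); apply: eq_bigr => s _.
rewrite /rescaled pushed_not_top ?divided_neq ?mulr1 //.
  by rewrite -val_eqE gtn_eqF.
by apply/negP => /and3P[/ctx_lt]; rewrite ltnNge (ltnW kl).
Qed.

End Step.

(** Levels are normalized from the last to the first. The start at [p] is void. *)
Lemma weight_normalize z tau : 0 < z -> (forall e, 0 < tau e) ->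
  exists z' rho, [/\ 0 < z', forall e, 0 < rho e, normalized_from T 0 rho &
    forall x, weight T z tau x = weight T z' rho x].
Proof.
move=> z0 t0.
suff /(_ p (leqnn p)) : forall n, (n <= p)%N -> exists z' rho,
    [/\ 0 < z', forall e, 0 < rho e, normalized_from T (p - n) rho &
    forall x, weight T z tau x = weight T z' rho x] by rewrite subnn.
elim=> [_|n IH np].
  by exists z, tau; split=> // x k; rewrite subn0 leqNgt ltn_ord.
have [z' [rho [z'0 r0 norm eqw]]] := IH (ltnW np).
pose k := Ordinal (rev_ord_proof (Ordinal np)).
have kS : (p - n)%N = k.+1 by rewrite /= -subSn ?subSS.
exists (z' * pushed_const k rho), (rescaled k rho); split.
- by rewrite mulr_gt0 ?pushed_const_gt0.
- exact: rescaled_gt0.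
- by apply: (rescaled_normalized (k := k) r0); rewrite -kS.
- by move=> x; rewrite eqw; exact: weight_rescaled.
Qed.

End Normalization.

(** * Fibers of the monomial map *)

Section Characters.
Variables (F : fieldType) (G : Type) (mul : G -> G -> G) (I : finType).
Variable chi : I -> G -> F.
Hypothesis chiM : forall i g h, chi i (mul g h) = chi i g * chi i h.
Hypothesis chi_neq0 : forall i g, chi i g != 0.
Variable g0 : G.

(** Dedekind's argument: if [chi i] and [chi j] differ at [h], subtracting [chi j h] times the
    relation from its translate by [h] removes the term of [j] and keeps that of [i]. *)
Lemma characters_independent (s : seq I) (a : I -> F) :
    uniq s -> {in s &, injective chi} ->
    (forall g, \sum_(i <- s) a i * chi i g = 0) ->
  forall i, i \in s -> a i = 0.
Proof.
elim: s a => // j s IH a /= /andP[js us] inj H.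
have as0 i : i \in s -> a i = 0.
  move=> si; have ij : chi i <> chi j.
    by move=> e; move: js; rewrite -(inj i j) ?inE ?eqxx ?si ?orbT.
  have /existsNP[h hij] : ~ forall h, chi i h = chi j h.
    by move=> e; apply: ij; apply/funext.
  have : a i * (chi i h - chi j h) = 0.
    apply: (IH (fun i => a i * (chi i h - chi j h))) => // [k l sk sl|g].
      by apply: inj; rewrite inE ?sk ?sl orbT.
    transitivity (\sum_(i <- j :: s) a i * chi i (mul h g)
                  - chi j h * \sum_(i <- j :: s) a i * chi i g).
      rewrite !big_cons chiM mulrDr opprD addrACA mulrCA mulrA subrr add0r.
      rewrite mulr_sumr -sumrB; apply: eq_bigr => k _; rewrite chiM; ring.
    by rewrite !H mulr0 subrr.
  by move/eqP; rewrite mulf_eq0 subr_eq0 => /orP[/eqP//|/eqP].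
move=> i; rewrite inE => /predU1P[->|]; last exact: as0.
have /eqP := H g0; rewrite big_cons big_seq big1 ?addr0 => [|k /as0 ->]; last exact: mul0r.
by rewrite mulf_eq0 (negPf (chi_neq0 _ _)) orbF => /eqP.
Qed.

(** Different indices may carry the same character; one index is chosen per character. *)
Definition char_rep i : I := odflt i [pick j | `[< chi i = chi j >]].

Lemma char_repP i : chi i = chi (char_rep i).
Proof. by rewrite /char_rep; case: pickP => //= j /asboolP. Qed.

Lemma char_rep_eq i j : chi i = chi j -> char_rep i = char_rep j.
Proof.
move=> e; rewrite /char_rep -(eq_pick (P := fun k => `[< chi i = chi k >])) => [|k].
  by case: pickP => // /(_ i) /asboolP.
by rewrite e.
Qed.

Lemma char_class_sum (a : I -> F) :
  (forall g, \sum_i a i * chi i g = 0) ->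
  forall j, \sum_(i | char_rep i == j) a i = 0.
Proof.
move=> H j; have [jr|jr] := eqVneq (char_rep j) j; last first.
  rewrite big1 // => i /eqP ij; case/eqP: jr.
  by rewrite -[in RHS]ij; apply: char_rep_eq; rewrite -ij -char_repP.
pose s := [seq j <- index_enum I | char_rep j == j].
apply: (characters_independent (s := s) (a := fun j => \sum_(i | char_rep i == j) a i)).
- exact/filter_uniq/index_enum_uniq.
- move=> k l; rewrite !mem_filter => /andP[/eqP kr _] /andP[/eqP lr _] e.
  by rewrite -kr -lr; exact: char_rep_eq.
- move=> g; rewrite big_filter -[RHS](H g) [RHS](partition_big char_rep
    (fun j => char_rep j == j)) /=; last first.
    by move=> i _; apply/eqP/char_rep_eq; rewrite -char_repP.
  apply: eq_bigr => k _; rewrite mulr_suml; apply: eq_bigr => i /eqP <-.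
  by rewrite -char_repP.
- by rewrite mem_filter jr eqxx mem_index_enum.
Qed.

End Characters.

Section IdealGen.
Variables (A : comNzRingType) (G : A -> Prop).

Lemma ideal_gen0 : ideal_gen G 0.
Proof. by exists 0%N, (fun=> 0), (fun=> 0); split; [case|rewrite big_ord0]. Qed.

Lemma ideal_gen_base g : G g -> ideal_gen G g.
Proof. by exists 1%N, (fun=> 1), (fun=> g); rewrite big_ord1 mul1r. Qed.

Lemma ideal_genD f g : ideal_gen G f -> ideal_gen G g -> ideal_gen G (f + g).
Proof.
move=> [m [a [u [Gu ->]]]] [n [b [v [Gv ->]]]]; exists (m + n)%N.
exists (fun i => match split i with inl j => a j | inr j => b j end).
exists (fun i => match split i with inl j => u j | inr j => v j end).
split=> [i|]; first by case: (split i).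
rewrite big_split_ord /=; congr (_ + _); apply: eq_bigr => i _.
  by rewrite (unsplitK (inl i)).
by rewrite (unsplitK (inr i)).
Qed.

Lemma ideal_genMl h f : ideal_gen G f -> ideal_gen G (h * f).
Proof.
move=> [m [a [u [Gu ->]]]]; exists m, (fun i => h * a i), u; split=> //.
by rewrite mulr_sumr; apply: eq_bigr => i _; rewrite mulrA.
Qed.

Lemma ideal_gen_sum (I : Type) (s : seq I) (f : I -> A) :
  (forall i, ideal_gen G (f i)) -> ideal_gen G (\sum_(i <- s) f i).
Proof. by move=> H; apply: big_ind => //; [exact: ideal_gen0|exact: ideal_genD]. Qed.

Lemma ideal_gen_trans g f h : ideal_gen G (f - g) -> ideal_gen G (g - h) -> ideal_gen G (f - h).
Proof. by move=> fg gh; have := ideal_genD fg gh; rewrite addrA subrK. Qed.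

End IdealGen.

(** * Connectedness of the fibers under saturated moves *)

Section Fibers.
Variables (R : realType) (p : nat) (d : 'I_p -> nat) (L : finType).
Variable T : staged_tree d L.
Hypothesis hT : CStree T.
Hypothesis hbal : balanced R T.
Implicit Types (x y w : outcome d) (s : seq (outcome d)) (i k l : 'I_p).
Implicit Types (z : R) (tau : L -> R) (f : prob_ring R d).

Definition mon s : prob_ring R d := \prod_(x <- s) pvar R x.

Lemma ev_mon z tau s : ev T z tau (mon s) = \prod_(x <- s) weight T z tau x.
Proof.
rewrite /ev rmorph_prod; apply: eq_bigr => x _; exact: ev_pvar.
Qed.

Lemma mon_perm s s' : perm_eq s s' -> mon s = mon s'.
Proof. exact: perm_big. Qed.

Lemma monomial_mon m : exists s, 'X_[m] = mon s.
Proof.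
rewrite mpolyXE_id; apply: (big_ind (fun f => exists s, f = mon s)) => [|_ _ [s ->] [s' ->]|i _].
- by exists [::]; rewrite /mon big_nil.
- by exists (s ++ s'); rewrite /mon big_cat.
- by exists (nseq (m i) (enum_val i)); rewrite /mon big_nseq iter_mulr_1 /pvar enum_valK.
Qed.

Lemma ev_csi_poly_unnormalized z tau st f : 0 < z -> (forall e, 0 < tau e) ->
  Sat T st -> csi_poly st f -> ev T z tau f = 0.
Proof.
move=> z0 t0 sat fst.
have [z' [rho [z'0 r0 norm eqw]]] := weight_normalize hT hbal z0 t0.
rewrite -(ev_csi_poly hT z'0 r0 norm sat fst) /ev; congr (meval _ f); apply/funext => j; exact: eqw.
Qed.

Lemma ev_I_Sat z tau f : 0 < z -> (forall e, 0 < tau e) -> I_Sat T f ->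
  ev T z tau f = 0.
Proof.
move=> z0 t0 [n [a [g [Gg ->]]]]; rewrite /ev raddf_sum big1 //= => i _.
have [st [sat fst]] := Gg i; rewrite mevalM -!/(ev T z tau _).
by rewrite (ev_csi_poly_unnormalized z0 t0 sat fst) mulr0.
Qed.

(** Equality of monomial images is tested at positive, not necessarily normalized, label values. *)
Definition same_fiber s s' := forall z tau, 0 < z -> (forall e, 0 < tau e) ->
  ev T z tau (mon s) = ev T z tau (mon s').

Lemma same_fiber_I_Sat s s' : I_Sat T (mon s - mon s') -> same_fiber s s'.
Proof.
move=> ss' z tau z0 t0; apply/eqP; rewrite -subr_eq0.
by have := ev_I_Sat z0 t0 ss'; rewrite /ev mevalB => ->.
Qed.

Lemma same_fiber_size s s' : same_fiber s s' -> size s = size s'.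
Proof.
move=> /(_ 2 (fun=> 1) (ltr0Sn _ 1) (fun=> ltr01)); rewrite !ev_mon.
have E u : \prod_(x <- u) weight T 2 (fun=> 1) x = 2 ^+ size u :> R.
  rewrite (eq_bigr (fun=> 2)) ?big_const_seq ?count_predT ?iter_mulr_1 // => x _.
  by rewrite /weight big1 // mulr1.
rewrite !E; apply: ieexprIn => //; by rewrite -[1]/(1%:R) eqr_nat.
Qed.

(** Weight 2 on this label and 1 on all others detects it: the monomial takes the value 1 if the
    label is absent and at least 2 if it occurs. *)
Lemma same_fiber_label s s' y k : same_fiber s s' -> y \in s' ->
  exists2 w, w \in s & lab T w k = lab T y k.
Proof.
move=> ss' ys'; pose e := lab T y k.
have [/hasP[w ws /eqP wy]|none] := boolP (has (fun w => lab T w k == e) s).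
  by exists w.
pose tau (e' : L) : R := if e' == e then 2 else 1.
have tau_ge1 e' : 1 <= tau e' by rewrite /tau; case: ifP => _; rewrite ?ler1n.
have tau_gt0 e' : 0 < tau e' by exact: lt_le_trans (tau_ge1 e').
have := ss' 1 tau ltr01 tau_gt0; rewrite !ev_mon big_seq big1 => [|x xs].
  rewrite (perm_big _ (perm_to_rem ys')) big_cons /= => E.
  have : 2 * 1 <= weight T 1 tau y * \prod_(j <- rem y s') weight T 1 tau j.
    apply: ler_pM => //.
      rewrite /weight mul1r (bigD1 k) //= {1}/tau eqxx -[leLHS]mulr1 ler_pM2l //.
      exact: prodr_ege1.
    apply: prodr_ege1 => x _; rewrite /weight mul1r; exact: prodr_ege1.
  by rewrite -E mulr1 -[1]/(1%:R) ler_nat.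
rewrite /weight mul1r big1 // => l _; rewrite /tau; case: eqP => // xle.
have lk := lab_level hT xle; subst l.
by case/hasP: none; exists x; rewrite // xle eqxx.
Qed.

Lemma same_fiber_row s s' y m : same_fiber s (y :: s') -> (m <= p)%N ->
  exists x s1, I_Sat T (mon s - mon (x :: s1)) /\ agree (before p m) x y.
Proof.
move=> fib; elim: m => [_|m IH mp].
  have := same_fiber_size fib; case: s {fib} => // x s _; exists x, s; split.
    by rewrite subrr; exact: ideal_gen0.
  by apply/agreeP => i; rewrite inE.
have [x [s1 [sx xy]]] := IH (ltnW mp); pose k := Ordinal mp.
have beforeS : before p m.+1 = before p m :|: [set k].
  by apply/setP => i; rewrite !inE orbC ltnS leq_eqVlt.
have agreeS x' : agree (before p m) x' y -> x' k = y k -> agree (before p m.+1) x' y.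
  by move=> x'y x'k; rewrite beforeS agree_setU x'y; apply/agreeP => i /set1P ->.
have [xk|xk] := eqVneq (x k) (y k); first by exists x, s1; split=> //; exact: agreeS.
have fib1 : same_fiber (x :: s1) (y :: s').
  by move=> z tau z0 t0; rewrite -fib //; apply/esym/(same_fiber_I_Sat sx).
(* The label of [y] at [k] occurs in some row [w], which is not [x] because the states at [k]
   differ. Then [x] and [w] share a stage at [k] and can exchange states. *)
have [w ws /esym/eqP] := same_fiber_label k fib1 (mem_head _ _).
rewrite lab_eq // => /andP[yw /eqP ywk].
have ws1 : w \in s1.
  by move: ws; rewrite inE => /predU1P[wx|//]; rewrite ywk wx eqxx in xk.
have ctxk : ctx T x k = ctx T y k.
  by apply: (ctx_eq hT); apply: agree_sub xy; apply/subsetP => i /ctx_lt; rewrite inE.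
have xw : agree (ctx T x k) x w.
  rewrite ctxk; apply: agree_trans yw; apply: agree_sub xy.
  by apply/subsetP => i /ctx_lt; rewrite inE.
have xwk : x k != w k by rewrite -ywk.
have [x' [w' [x'x x'k [st [sat pst]]]]] := saturated_move hT hbal xw xwk.
exists x', (w' :: rem w s1); split; last first.
  by apply: agreeS; [exact: agree_trans xy|rewrite x'k].
apply: (ideal_gen_trans sx).
rewrite (mon_perm (s := x :: s1) (s' := x :: w :: rem w s1)) ?perm_cons ?perm_to_rem //.
rewrite /mon !big_cons !mulrA -mulrBl mulrC.
by apply/ideal_genMl/ideal_gen_base; exists st.
Qed.

(** A row made equal is cancelled on both sides, by positivity of its weight, and the remaining rows
    are treated by induction. *)
Lemma same_fiber_connected s s' : same_fiber s s' -> I_Sat T (mon s - mon s').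
Proof.
elim: s' s => [|y s' IH] s fib.
  have /size0nil -> := same_fiber_size fib; rewrite subrr; exact: ideal_gen0.
have [x [s1 [sx xy]]] := same_fiber_row fib (leqnn p).
have {}xy : x = y.
  by apply/ffunP => i; apply: (agree_at xy); rewrite inE.
rewrite {}xy in sx; apply: (ideal_gen_trans sx).
rewrite /mon !big_cons -mulrBr; apply/ideal_genMl/IH => z tau z0 t0.
have := fib z tau z0 t0; rewrite (same_fiber_I_Sat sx) // !ev_mon !big_cons.
by apply: mulfI; rewrite gt_eqF // weight_gt0.
Qed.

Lemma ev0_I_Sat f :
  (forall z tau, 0 < z -> (forall e, 0 < tau e) -> ev T z tau f = 0) -> I_Sat T f.
Proof.
(* Positive points multiply coordinatewise, and each monomial of [f] is a character on them. *)
move=> H; pose Gp := {w : R * (L -> R) | 0 < w.1 /\ forall e, 0 < w.2 e}.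
have mul_proof (g h : Gp) : 0 < (sval g).1 * (sval h).1 /\
    forall e, 0 < (sval g).2 e * (sval h).2 e.
  by have [g1 g2] := svalP g; have [h1 h2] := svalP h; split=> [|e]; rewrite mulr_gt0.
pose mul g h : Gp := exist _ (_, _) (mul_proof g h).
pose n := size (msupp f); pose ms (t : 'I_n) := tnth (in_tuple (msupp f)) t.
pose chi t (g : Gp) := ev T (sval g).1 (sval g).2 'X_[R, ms t].
have fE : f = \sum_t f@_(ms t) *: 'X_[ms t] by rewrite {1}(mpolyE f) big_tnth.
have chiM t g h : chi t (mul g h) = chi t g * chi t h.
  have [s sE] := monomial_mon (ms t); rewrite /chi sE !ev_mon -big_split.
  apply: eq_bigr => x _; rewrite /weight /= big_split /=; ring.
have chi0 t g : chi t g != 0.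
  have [s sE] := monomial_mon (ms t); rewrite /chi sE !ev_mon gt_eqF // prodr_gt0 // => x _.
  by have [g1 g2] := svalP g; exact: weight_gt0.
have g0 : Gp by exists (1, fun=> 1).
have sums := @char_class_sum R Gp mul _ chi chiM chi0 g0 (fun t => f@_(ms t)).
have {}sums j : \sum_(t | char_rep chi t == j) f@_(ms t) = 0.
  apply: sums => g; have [g1 g2] := svalP g; rewrite -[RHS](H _ _ g1 g2).
  rewrite [in RHS]fE /ev raddf_sum; apply: eq_bigr => t _; by rewrite /= mevalZ.
(* The subtracted representatives cancel, since the coefficients of each class sum to 0. *)
have -> : f = \sum_t f@_(ms t) *: ('X_[ms t] - 'X_[ms (char_rep chi t)]).
  rewrite [LHS]fE -[LHS]subr0.
  have {2}<- : \sum_t f@_(ms t) *: 'X_[R, ms (char_rep chi t)] = 0.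
    rewrite (partition_big (char_rep chi) predT) //= big1 // => j _.
    rewrite (eq_bigr (fun t => f@_(ms t) *: 'X_[ms j])) => [|t /eqP -> //].
    by rewrite -scaler_suml sums scale0r.
  by rewrite -sumrB; apply: eq_bigr => t _; rewrite scalerBr.
apply: ideal_gen_sum => t; rewrite -mul_mpolyC; apply: ideal_genMl.
have [s sE] := monomial_mon (ms t); have [s' s'E] := monomial_mon (ms (char_rep chi t)).
rewrite sE s'E; apply: same_fiber_connected => z tau z0 t0.
have /(congr1 (fun h => h (exist _ (z, tau) (conj z0 t0)))) := char_repP chi t.
by rewrite /chi sE s'E.
Qed.

End Fibers.

(** * The kernel of psi *)

Section Parametrization.
Variables (R : realType) (p : nat) (d : 'I_p -> nat) (L : finType).
Variable T : staged_tree d L.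
Implicit Types (x y : outcome d) (i k l : 'I_p) (z : R) (rho tau : L -> R).

Definition lift_const : R -> {poly label_ring R T} := polyC \o @mpolyC _ R.

Definition lift_image x : {poly label_ring R T} :=
  'X * (\prod_(i < p) label_var R T (path_edge x i))%:P.

HB.instance Definition _ := GRing.RMorphism.on lift_const.

(** The map before passing to the quotient by [theta_ideal], where labels can be evaluated
    freely. *)
Definition lift_psi : prob_ring R d -> {poly label_ring R T} :=
  mmap lift_const (fun j => lift_image (enum_val j)).

HB.instance Definition _ := GRing.RMorphism.on lift_psi.

Lemma lift_psi_pvar x : lift_psi (pvar R x) = lift_image x.
Proof. by rewrite /lift_psi mmapX mmap1U enum_rankK. Qed.

Lemma psi_lift (f : prob_ring R d) :
  psi T f = map_poly \pi_({ideal_quot (@theta_ideal R p d L T)})%qT (lift_psi f).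
Proof.
rewrite /psi /lift_psi /mmap raddf_sum; apply: eq_bigr => m _.
rewrite /= rmorphM /= map_polyC; congr (_ * _).
rewrite /mmap1 rmorph_prod; apply: eq_bigr => j _.
rewrite /= rmorphXn rmorphM /= map_polyX map_polyC /= rmorph_prod //.
Qed.

Lemma ev_lift z rho (f : prob_ring R d) :
  (map_poly (meval (label_point rho)) (lift_psi f)).[z] = ev T z rho f.
Proof.
rewrite /ev [RHS]/meval [RHS]/mmap /lift_psi /mmap raddf_sum horner_sum; apply: eq_bigr => m _.
rewrite /= rmorphM /= map_polyC hornerM hornerC /= mevalC; congr (_ * _).
rewrite /mmap1 rmorph_prod horner_prod; apply: eq_bigr => j _.
rewrite /= rmorphXn rmorphM /= map_polyX map_polyC horner_exp hornerM hornerX hornerC.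
rewrite /= rmorph_prod; congr ((_ * _) ^+ _); apply: eq_bigr => k _.
exact: meval_label_var.
Qed.

Lemma theta_ideal_ev rho (g : label_ring R T) : normalized_from T 0 rho ->
  g \in theta_ideal (R := R) (T := T) -> meval (label_point rho) g = 0.
Proof.
move=> norm /asboolP[n [a [h [Gh ->]]]]; rewrite raddf_sum big1 //= => i _.
have [k [v ->]] := Gh i; rewrite mevalM mevalB meval1 raddf_sum.
have [x ->] := level_anc (state_gt0 T) v.
rewrite (big_imset _ (in2W (@edge_of_inj _ _ _ _))) /= -[X in _ - X](norm x k) //.
rewrite (eq_bigr (fun s : 'I_(d k) => rho (lab T (upd x s) k))); first by rewrite subrr mulr0.
move=> s _; rewrite meval_label_var; congr (rho (T _)).
rewrite /path_edge upd_eq; congr (edge_of _ _); apply/eqP; rewrite anc_eq.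
by apply/agreeP => j; rewrite inE => jk; rewrite upd_lt.
Qed.

Lemma psi0_ev z rho f : psi T f = 0 -> normalized_from T 0 rho -> ev T z rho f = 0.
Proof.
move=> f0 norm; rewrite -ev_lift.
suff -> : map_poly (meval (label_point rho)) (lift_psi f) = 0 by rewrite horner0.
apply/polyP => i; rewrite coef0 coef_map /=; apply: theta_ideal_ev => //.
move/polyP/(_ i): f0; rewrite psi_lift coef_map coef0 => /eqP.
by rewrite -[X in _ == X](rmorph0 \pi_({ideal_quot (@theta_ideal R p d L T)})%qT) -Quotient.idealrBE subr0.
Qed.

Hypothesis hT : CStree T.
Hypothesis hbal : balanced R T.

Definition label_count x (u : used_label T) : nat :=
  #|[pred l | edge_label T (path_edge x l) == u]|.

Lemma prod_label_count (A : comNzRingType) (h : used_label T -> A) x :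
  \prod_l h (edge_label T (path_edge x l)) = \prod_u h u ^+ label_count x u.
Proof.
rewrite (partition_big (fun l => edge_label T (path_edge x l)) predT) //=.
apply: eq_bigr => u _; rewrite (eq_bigr (fun=> h u)) => [|l /eqP -> //].
by rewrite prodr_const.
Qed.

Lemma weight_label_count x (u : used_label T) :
  weight T 1 (fun e => if e == val u then 2 else 1) x = 2 ^+ label_count x u :> R.
Proof.
rewrite /weight mul1r.
have := prod_label_count (fun v : used_label T => if v == u then 2 else 1 : R) x.
rewrite [RHS](bigD1 u) //= eqxx [X in _ * X]big1 ?mulr1 => [<-|v /negPf ->]; last exact: expr1n.
by apply: eq_bigr => l _; rewrite -val_eqE.
Qed.

Lemma mulXpolyC (A : comNzRingType) (a b : A) :
  ('X * a%:P) * ('X * b%:P) = 'X * 'X * (a * b)%:P.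
Proof. by rewrite mulrACA polyCM. Qed.

(** The binomial vanishes even before the quotient: soundness at the unnormalized point with one
    label equal to 2 compares the exponents of that label in the two terms. *)
Lemma psi_csi_poly st (f : prob_ring R d) : Sat T st -> csi_poly st f -> psi T f = 0.
Proof.
move=> sat fst; suff lift0 : lift_psi f = 0 by rewrite psi_lift lift0 raddf0.
have [x [y [_ fE]]] := fst; move: fE.
set y1 := mix _ y x; set y2 := mix _ y x; set y3 := mix _ y x => fE.
have countE u :
    (label_count x u + label_count y1 u = label_count y2 u + label_count y3 u)%N.
  pose tau (e : L) : R := if e == val u then 2 else 1.
  have tau_gt0 e : 0 < tau e by rewrite /tau; case: ifP.
  have /eqP := ev_csi_poly_unnormalized hT hbal ltr01 tau_gt0 sat fst.
  rewrite fE /ev mevalB !mevalM -!/(ev _ _ _) !ev_pvar !weight_label_count -!exprD.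
  by rewrite subr_eq0 => /eqP /ieexprIn; apply; rewrite // -[1]/(1%:R) eqr_nat.
have lift_imageE x' : lift_image x' =
    'X * (\prod_u 'X_(enum_rank u) ^+ label_count x' u)%:P.
  by rewrite /lift_image -prod_label_count.
have imageM x' x'' : lift_psi (pvar R x' * pvar R x'') = 'X * 'X *
    (\prod_u 'X_(enum_rank u) ^+ (label_count x' u + label_count x'' u))%:P.
  rewrite rmorphM /= !lift_psi_pvar !lift_imageE mulXpolyC; congr (_ * _%:P).
  by rewrite -big_split; apply: eq_bigr => u _; rewrite exprD.
rewrite fE rmorphB /= !imageM.
by rewrite (eq_bigr _ (fun u _ => congr1 _ (countE u))) subrr.
Qed.

Lemma psi_I_Sat (f : prob_ring R d) : I_Sat T f -> psi T f = 0.
Proof.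
move=> [n [a [g [Gg ->]]]]; rewrite raddf_sum big1 //= => i _.
by have [st [sat gst]] := Gg i; rewrite rmorphM /= (psi_csi_poly sat gst) mulr0.
Qed.

End Parametrization.

Theorem theorem5p3 (R : realType) (p : nat) (d : 'I_p -> nat) (L : finType)
    (T : staged_tree d L) (hT : CStree T) (hbal : balanced R T)
    (f : prob_ring R d) :
  psi T f = 0 <-> I_Sat T f.
Proof.
split=> [f0|]; last exact: psi_I_Sat.
(* Any positive point has the same weights as a normalized one, where [f] vanishes because its image
   does. *)
apply: (ev0_I_Sat hT hbal) => z tau z0 t0.
have [z' [rho [z'0 r0 norm eqw]]] := weight_normalize hT hbal z0 t0.
rewrite -(psi0_ev z' f0 norm) /ev; congr (meval _ f); apply/funext => j; exact: eqw.
Qed.
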